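(* There exist functions $h_0, h_1 : \mathbb{Z}^3 \to \mathbb{Z}$, each having finite support in the last variable for fixed values of the first two, such that for all integers $m, n \geq 0$, \[U^{(0)}\left(\frac{x^m}{(1+5x)^n}\right) = \frac{1}{(1+5x)^{5n+5}} \sum_{r \geq \lceil (m+4)/5 \rceil} h_0(m,n,r) \cdot 5^{\pi_0(m,r)} \cdot x^r,\] \[U^{(1)}\left(\frac{x^m}{(1+5x)^n}\right) = \frac{1}{(1+5x)^{5n}} \sum_{r \geq \lceil m/5 \rceil} h_1(m,n,r) \cdot 5^{\pi_1(m,r)} \cdot x^r,\] where $\pi_0(m,r) = \max\left(0, \left\lfloor \frac{5r-m+2}{7} \right\rfloor -5 \right)$ and $\pi_1(m,r) = \left\lfloor \frac{5r-m}{7} \right\rfloor$.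
   Context: All functions are treated as formal Laurent series in $q$. For $r\ge1$, $f_r = \prod_{n\ge1}(1-q^{rn})$. Let $x = q\frac{f_2 f_{10}^3}{f_1^3 f_5}$; since $x=q+O(q^2)$, $x^m/(1+5x)^n$ is a well-defined Laurent series in $q$. Let $\Phi = q^5 \frac{f_{25}f_{50}^2}{f_1f_2^2}$, let $U_5\left(\sum_{n} a(n)q^n\right) = \sum_{n} a(5n)q^n$, and define $U^{(0)}(f) = U_5(\Phi f)$ and $U^{(1)}(f) = U_5(f)$. *)

(* Defs.v *)
From HB Require Import structures.
From mathcomp Require Import all_boot all_order all_algebra.
From mathcomp Require Import all_classical.
From mathcomp Require Import zify.

Set Implicit Arguments.
Unset Strict Implicit.
Unset Printing Implicit Defensive.

Import Order.TTheory GRing.Theory Num.Theory.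

Local Open Scope classical_set_scope.
Local Open Scope ring_scope.

(* Formal Laurent series over R in one variable q: the family of coefficients,
   indexed by int, vanishes below some index. *)

Definition bounded_below (R : nmodType) : {pred int -> R} :=
  fun a => `[< exists N : int, forall n, n < N -> a n = 0 >].

Record laurent (R : nmodType) := Laurent {
  lcoef : int -> R;
  lcoefP : lcoef \in @bounded_below R
}.

HB.instance Definition _ (R : nmodType) := [isSub for @lcoef R].
HB.instance Definition _ (R : nmodType) := [Choice of laurent R by <:].

Lemma bounded_belowP (R : nmodType) (a : int -> R) :
  reflect (exists N : int, forall n, n < N -> a n = 0)
          (a \in @bounded_below R).
Proof. exact: asboolP. Qed.

Lemma bounded_below_zmod (R : zmodType) : zmod_closed (@bounded_below R).
Proof.
split; first by apply/bounded_belowP; exists 0.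
move=> a b /bounded_belowP[N aN] /bounded_belowP[M bM].
apply/bounded_belowP; exists (Order.min N M) => n.
rewrite lt_min => /andP[nN nM].
have -> : (a - b) n = a n - b n by [].
by rewrite aN// bM// subr0.
Qed.

HB.instance Definition _ (R : zmodType) :=
  GRing.isZmodClosed.Build (int -> R) (@bounded_below R)
    (bounded_below_zmod R).
HB.instance Definition _ (R : zmodType) :=
  [SubChoice_isSubZmodule of laurent R by <:].

Lemma lcoef0 (R : zmodType) n : lcoef (0 : laurent R) n = 0.
Proof. by []. Qed.

Lemma lcoefD (R : zmodType) (a b : laurent R) n :
  lcoef (a + b) n = lcoef a n + lcoef b n.
Proof. by []. Qed.

Lemma laurentP (R : nmodType) (a b : laurent R) :
  (forall n, lcoef a n = lcoef b n) -> a = b.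
Proof. by move=> ab; apply/val_inj/funext. Qed.

Lemma lcoef_bound (R : nmodType) (a : laurent R) :
  exists N : nat, forall n, n < - N%:Z -> lcoef a n = 0.
Proof.
have /bounded_belowP[N aN] := lcoefP a.
by exists `|N|%N => n nN; apply: aN; lia.
Qed.

Section Mul.
Variable R : comNzRingType.
Implicit Types a b c : laurent R.

(* For fixed n only finitely many terms of this sum are nonzero. *)
Definition lmul_coef a b (n : int) : R :=
  \sum_(i \in [set: int]) lcoef a i * lcoef b (n - i).

Lemma lmul_coefE a b n (s : seq int) : uniq s ->
    (forall i, lcoef a i * lcoef b (n - i) != 0 -> i \in s) ->
  lmul_coef a b n = \sum_(i <- s) lcoef a i * lcoef b (n - i).
Proof.
move=> us Hs; rewrite /lmul_coef (fsbigE s)//.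
  by apply: eq_bigl => i; rewrite in_setT.
by move=> i _ /negP nis; apply/eqP/negP => /negP /Hs.
Qed.

Lemma lmul_bound a b : lmul_coef a b \in @bounded_below R.
Proof.
have [N aN] := lcoef_bound a; have [M bM] := lcoef_bound b.
apply/bounded_belowP; exists (- N%:Z - M%:Z) => n nNM.
rewrite (@lmul_coefE _ _ _ [::])// ?big_nil// => i /eqP[].
have [iN|iN] := ltP i (- N%:Z); first by rewrite aN ?mul0r.
by rewrite bM ?mulr0//; lia.
Qed.

Definition lmul a b := Laurent (lmul_bound a b).

Definition box (N : nat) : seq int := [seq i%:Z - N%:Z | i <- iota 0 (N + N).+1].

Lemma box_uniq N : uniq (box N).
Proof. by rewrite map_inj_uniq ?iota_uniq// => i j; lia. Qed.

Lemma mem_box N i : (i \in box N) = (- N%:Z <= i <= N%:Z).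
Proof.
apply/mapP/idP => [[j]|iN]; first by rewrite mem_iota; lia.
by exists (absz (i + N%:Z)); rewrite ?mem_iota; lia.
Qed.

Lemma lmulC : commutative lmul.
Proof.
move=> a b; apply: laurentP => n.
have [N aN] := lcoef_bound a; have [M bM] := lcoef_bound b.
have sup i : lcoef a i * lcoef b (n - i) != 0 -> - N%:Z <= i <= n + M%:Z.
  move=> nz; apply/andP; split; rewrite leNgt; apply: contraNN nz => h.
    by rewrite aN ?mul0r.
  by rewrite bM ?mulr0//; lia.
set K := (N + M + `|n|)%N.
rewrite /= (@lmul_coefE a b n (box K)) ?box_uniq//; last first.
  by move=> i /sup; rewrite mem_box; lia.
rewrite (@lmul_coefE b a n [seq n - i | i <- box K]).
- rewrite [RHS]big_map; apply: eq_bigr => i _; rewrite mulrC.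
  by have -> : n - (n - i) = i by lia.
- by rewrite map_inj_uniq ?box_uniq// => i j; lia.
- move=> i; rewrite mulrC => nz; apply/mapP; exists (n - i); last by lia.
  have := sup (n - i); have -> : n - (n - i) = i by lia.
  by move=> /(_ nz); rewrite mem_box; lia.
Qed.

Lemma lmulDl : left_distributive lmul +%R.
Proof.
move=> a b c; apply: laurentP => n; rewrite lcoefD /=.
have [N aN] := lcoef_bound a; have [M bM] := lcoef_bound b.
have [P cP] := lcoef_bound c.
set K := (N + M + P + `|n|)%N.
have out i : i \notin box K -> (lcoef a i = 0 /\ lcoef b i = 0) \/ lcoef c (n - i) = 0.
  rewrite mem_box => iK.
  have [h|h] := ltP i (- K%:Z); [left|right].
    by split; [apply: aN|apply: bM]; lia.
  by apply: cP; lia.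
have sup (d : laurent R) : (forall i, i \notin box K ->
    lcoef d i = 0 \/ lcoef c (n - i) = 0) ->
    forall i, lcoef d i * lcoef c (n - i) != 0 -> i \in box K.
  move=> Hd i; apply: contraNT => /Hd[] ->; by rewrite ?mul0r ?mulr0.
rewrite !(@lmul_coefE _ _ _ (box K)) ?box_uniq -?big_split//=.
- by apply: eq_bigr => i _; rewrite -mulrDl.
- by apply: sup => i /out[[]|]; auto.
- by apply: sup => i /out[[]|]; auto.
- by apply: (sup (a + b)) => i /out[[ha hb]|]; [left; rewrite lcoefD ha hb addr0|right].
Qed.

Lemma lmulA : associative lmul.
Proof.
move=> a b c; apply: laurentP => n /=.
have [N aN] := lcoef_bound a; have [M bM] := lcoef_bound b.
have [P cP] := lcoef_bound c.
set K := (N + M + P + `|n|)%N; set L := (K + K)%N.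
have supab m : lmul_coef a b m != 0 -> - (N + M)%N%:Z <= m.
  rewrite leNgt; apply: contraNN => h.
  rewrite (@lmul_coefE _ _ _ [::]) ?big_nil// => i /eqP[].
  have [iN|iN] := ltP i (- N%:Z); first by rewrite aN ?mul0r.
  by rewrite bM ?mulr0//; lia.
have supbc m : lmul_coef b c m != 0 -> - (M + P)%N%:Z <= m.
  rewrite leNgt; apply: contraNN => h.
  rewrite (@lmul_coefE _ _ _ [::]) ?big_nil// => i /eqP[].
  have [iN|iN] := ltP i (- M%:Z); first by rewrite bM ?mul0r.
  by rewrite cP ?mulr0//; lia.
rewrite (@lmul_coefE _ _ _ (box K)) ?box_uniq//; last first.
  move=> i; rewrite mem_box => nz.
  have hi : - N%:Z <= i.
    by rewrite leNgt; apply: contraNN nz => h; rewrite aN ?mul0r.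
  have /supbc : lmul_coef b c (n - i) != 0.
    by apply: contraNN nz => /eqP /= ->; rewrite mulr0.
  by lia.
rewrite (@lmul_coefE _ c _ (box K)) ?box_uniq//; last first.
  move=> i; rewrite mem_box => nz.
  have hi : - P%:Z <= n - i.
    by rewrite leNgt; apply: contraNN nz => h; rewrite cP ?mulr0.
  have /supab : lmul_coef a b i != 0.
    by apply: contraNN nz => /eqP /= ->; rewrite mul0r.
  by lia.
have -> : \sum_(i <- box K) lcoef (lmul a b) i * lcoef c (n - i) =
  \sum_(i <- box K) \sum_(j <- box K)
    lcoef a j * lcoef b (i - j) * lcoef c (n - i).
  apply: eq_big_seq => i; rewrite mem_box => iK.
  have [h|h] := ltP (n - i) (- P%:Z).
    by rewrite cP// mulr0 big1// => j _; rewrite mulr0.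
  rewrite /= (@lmul_coefE _ _ _ (box K)) ?box_uniq ?mulr_suml//.
  move=> j; rewrite mem_box => nz.
  have hj : - N%:Z <= j.
    by rewrite leNgt; apply: contraNN nz => hh; rewrite aN ?mul0r.
  have hj' : - M%:Z <= i - j.
    by rewrite leNgt; apply: contraNN nz => hh; rewrite bM ?mulr0.
  by lia.
rewrite exchange_big; apply: eq_big_seq => j; rewrite mem_box => jK /=.
have [h|h] := ltP j (- N%:Z).
  by rewrite aN// mul0r big1// => i _; rewrite !mul0r.
rewrite (@lmul_coefE b c _ [seq i - j | i <- box K]).
- rewrite mulr_sumr [LHS]big_map; apply: eq_bigr => i _; rewrite mulrA.
  by have -> : n - j - (i - j) = n - i by lia.
- by rewrite map_inj_uniq ?box_uniq// => i i'; lia.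
- move=> i nz; apply/mapP; exists (i + j); last by lia.
  have hi : - M%:Z <= i.
    by rewrite leNgt; apply: contraNN nz => hh; rewrite bM ?mul0r.
  have hi' : - P%:Z <= n - j - i.
    by rewrite leNgt; apply: contraNN nz => hh; rewrite cP ?mulr0.
  by rewrite mem_box; lia.
Qed.

Definition lmono_coef (k : int) (n : int) : R := (n == k)%:R.

Lemma lmono_bound k : lmono_coef k \in @bounded_below R.
Proof.
by apply/bounded_belowP; exists k => n nk; rewrite /lmono_coef lt_eqF.
Qed.

(* lmono k is the monomial q^k. *)
Definition lmono k := Laurent (lmono_bound k).

Lemma lmonoM k a n : lcoef (lmul (lmono k) a) n = lcoef a (n - k).
Proof.
rewrite /= (@lmul_coefE _ _ _ [:: k])// ?big_seq1 /= /lmono_coef ?eqxx ?mul1r//.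
by move=> i; rewrite inE /= /lmono_coef; case: (i =P k) => // _; rewrite mul0r eqxx.
Qed.

Lemma lmul1 : left_id (lmono 0) lmul.
Proof. by move=> a; apply: laurentP => n; rewrite lmonoM subr0. Qed.

Lemma laurent1_neq0 : lmono 0 != 0.
Proof.
apply/eqP => /(congr1 (fun a : laurent R => lcoef a 0)) /eqP.
by rewrite /= /lmono_coef eqxx oner_eq0.
Qed.

HB.instance Definition _ := GRing.Zmodule_isComNzRing.Build (laurent R)
  lmulA lmulC lmul1 lmulDl laurent1_neq0.

Lemma lcoefM a b n :
  lcoef (a * b) n = \sum_(i \in [set: int]) lcoef a i * lcoef b (n - i).
Proof. by []. Qed.

Lemma lcoef1 n : lcoef (1 : laurent R) n = (n == 0)%:R.
Proof. by []. Qed.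

(* The inverse is the ring inverse where one exists, and the identity
   elsewhere. *)
Definition lunit : {pred laurent R} := fun a => `[< exists b, b * a = 1 >].

Definition linv a : laurent R :=
  if pselect (exists b, b * a = 1) is left ab then projT1 (cid ab) else a.

Lemma lmulVx : {in lunit, left_inverse 1 linv *%R}.
Proof.
move=> a /asboolP au; rewrite /linv; case: pselect => //= ab.
exact: projT2 (cid ab).
Qed.

Lemma lunitPl a b : b * a = 1 -> lunit a.
Proof. by move=> ba; apply/asboolP; exists b. Qed.

Lemma linv_out : {in [predC lunit], linv =1 id}.
Proof. by move=> a /asboolPn nau; rewrite /linv; case: pselect. Qed.

HB.instance Definition _ := GRing.ComNzRing_hasMulInverse.Build (laurent R)
  lmulVx lunitPl linv_out.

End Mul.

Lemma lmono_unit (R : comNzRingType) k : lmono R k \is a GRing.unit.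
Proof.
apply: (@lunitPl _ _ (lmono R (- k))); apply: laurentP => n.
by rewrite lmonoM /= /lmono_coef; congr ((_ : bool)%:R); lia.
Qed.

Section Units.
Variable R : comNzRingType.
Implicit Types a b : laurent R.

(* Power series with constant term 1; they are units. *)
Definition monic_series a := (forall n, n < 0 -> lcoef a n = 0) /\ lcoef a 0 = 1.

Lemma lcoefM_series a b (n : nat) :
    (forall n, n < 0 -> lcoef a n = 0) -> (forall n, n < 0 -> lcoef b n = 0) ->
  lcoef (a * b) n = \sum_(i < n.+1) lcoef a i * lcoef b (n - i)%N.
Proof.
move=> a0 b0; rewrite [LHS](@lmul_coefE _ a b n [seq i%:Z | i <- iota 0 n.+1]).
- rewrite big_map -[iota 0 n.+1]/(index_iota 0 n.+1) big_mkord.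
  by apply: eq_bigr => i _; congr (_ * lcoef b _); have := ltn_ord i; lia.
- by rewrite map_inj_uniq ?iota_uniq// => i j; lia.
- move=> i nz; apply/mapP; exists (absz i).
    rewrite mem_iota; have : ~~ (n%:Z - i < 0).
      by apply: contraNN nz => /b0 ->; rewrite mulr0.
    have : ~~ (i < 0) by apply: contraNN nz => /a0 ->; rewrite mul0r.
    by lia.
  have : ~~ (i < 0) by apply: contraNN nz => /a0 ->; rewrite mul0r.
  by lia.
Qed.

Lemma lcoefM_lt0 a b n :
    (forall n, n < 0 -> lcoef a n = 0) -> (forall n, n < 0 -> lcoef b n = 0) ->
  n < 0 -> lcoef (a * b) n = 0.
Proof.
move=> a0 b0 n0; rewrite [LHS](@lmul_coefE _ a b n [::]) ?big_nil// => i /eqP[].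
have [h|h] := ltP i 0; first by rewrite a0 ?mul0r.
by rewrite b0 ?mulr0//; lia.
Qed.

Lemma monic_seriesM a b :
  monic_series a -> monic_series b -> monic_series (a * b).
Proof.
move=> [a0 a1] [b0 b1]; split; first by move=> n; exact: lcoefM_lt0.
by rewrite lcoefM_series// big_ord1 a1 b1 mul1r.
Qed.

Lemma monic_series1 : monic_series 1.
Proof. by split => [n n0|]; rewrite lcoef1 ?eqxx// lt_eqF. Qed.

Lemma monic_seriesX a k : monic_series a -> monic_series (a ^+ k).
Proof.
move=> am; elim: k => [|k IH]; first by rewrite expr0; exact: monic_series1.
by rewrite exprS; exact: monic_seriesM.
Qed.

Fixpoint inv_coefs a (n : nat) : seq R :=
  if n is n'.+1 then
    let s := inv_coefs a n' in
    rcons s (- \sum_(i < n') s`_i * lcoef a (n' - i)%N + (n' == 0)%N%:R)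
  else [::].

Lemma size_inv_coefs a n : size (inv_coefs a n) = n.
Proof. by elim: n => //= n IH; rewrite size_rcons IH. Qed.

Lemma nth_inv_coefs a n i :
  (i < n)%N -> (inv_coefs a n)`_i = (inv_coefs a i.+1)`_i.
Proof.
elim: n => // n IH; rewrite ltnS leq_eqVlt => /orP[/eqP->//|iltn].
by rewrite {1}/inv_coefs -/inv_coefs nth_rcons size_inv_coefs iltn IH.
Qed.

Definition inv_coef a (n : int) : R :=
  if n is Posz k then (inv_coefs a k.+1)`_k else 0.

Lemma inv_bound a : inv_coef a \in @bounded_below R.
Proof. by apply/bounded_belowP; exists 0 => -[]. Qed.

Lemma monic_series_inv a :
  monic_series a -> exists2 b, monic_series b & b * a = 1.
Proof.
move=> [a0 a1]; set b := Laurent (inv_bound a).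
have b0 n : n < 0 -> lcoef b n = 0 by case: n.
exists b.
  by split=> //=; rewrite big_ord0 oppr0 add0r.
apply: laurentP => -[n|n]; last by rewrite lcoefM_lt0// lcoef1.
have bE : lcoef b n =
    - \sum_(i < n) lcoef b i * lcoef a (n - i)%N + (n == 0)%N%:R.
  rewrite [LHS]nth_rcons size_inv_coefs ltnn eqxx; congr (- _ + _).
  by apply: eq_bigr => i _; rewrite [in LHS]nth_inv_coefs.
rewrite lcoefM_series// big_ord_recr.
rewrite -[LHS]/(\sum_(i < n) lcoef b i * lcoef a (n - i)%N +
                lcoef b n * lcoef a (n - n)%N).
by rewrite subnn a1 mulr1 bE addrA subrr add0r.
Qed.

Lemma monic_series_unit a : monic_series a -> a \is a GRing.unit.
Proof. by move=> /monic_series_inv[b _]; exact: lunitPl. Qed.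

Lemma monic_seriesV a : monic_series a -> monic_series a^-1.
Proof.
move=> am; have [b bm ba] := monic_series_inv am.
by rewrite -[a^-1]mul1r -ba mulrK// monic_series_unit.
Qed.

End Units.

(* The coefficient of q^k in f_r = \prod_(j >= 1) (1 - q^(r j)) is read off the
   partial product over j <= k: for r >= 1 the omitted factors are 1 modulo
   q^(k+1) (euler_coef_stable). *)
Definition euler_coef (r : nat) (n : int) : int :=
  if n is Posz k then
    (\prod_(1 <= j < k.+1) (1 - 'X^(r * j)) : {poly int})`_k
  else 0.

Lemma euler_coef_stable (r k N : nat) : (0 < r)%N -> (k <= N)%N ->
  (\prod_(1 <= j < N.+1) (1 - 'X^(r * j)) : {poly int})`_k = euler_coef r k.
Proof.
move=> r0 /subnKC <-; elim: (N - k)%N => [|d IH]; first by rewrite addn0.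
rewrite addnS big_nat_recr//= mulrBr mulr1 coefB IH coefMXn.
by rewrite ifT ?subr0//; nia.
Qed.

Lemma euler_bound r : euler_coef r \in @bounded_below int.
Proof. by apply/bounded_belowP; exists 0 => -[]. Qed.

Definition f (r : nat) : laurent int := Laurent (euler_bound r).

Definition q : laurent int := lmono int 1.

Definition x : laurent int := q * (f 2 * f 10 ^+ 3 / (f 1 ^+ 3 * f 5)).

Definition Phi : laurent int :=
  q ^+ 5 * (f 25 * f 50 ^+ 2 / (f 1 * f 2 ^+ 2)).

Lemma U5_bound (a : laurent int) :
  (fun n => lcoef a (5 * n)) \in @bounded_below int.
Proof.
have [N aN] := lcoef_bound a.
by apply/bounded_belowP; exists (- N%:Z) => n nN; apply: aN; lia.
Qed.

Definition U5 (a : laurent int) : laurent int := Laurent (U5_bound a).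

Definition U0 (a : laurent int) : laurent int := U5 (Phi * a).
Definition U1 (a : laurent int) : laurent int := U5 a.

Definition pi0 (m r : int) : int :=
  Num.max 0 (Num.floor ((5 * r - m + 2)%:~R / 7 : rat) - 5).

(* Nonnegative as soon as m <= 5 r, so 5 ^ pi1 m r is then an honest power in
   int. *)
Definition pi1 (m r : int) : int := Num.floor ((5 * r - m)%:~R / 7 : rat).

Lemma f_monic r : (0 < r)%N -> monic_series (f r).
Proof. by move=> r0; split => [[]//|] /=; rewrite big_geq// coef1. Qed.

Lemma f_unit r : (0 < r)%N -> f r \is a GRing.unit.
Proof. by move=> /f_monic /monic_series_unit. Qed.

Lemma x_cofactor_monic :
  monic_series (f 2 * f 10 ^+ 3 / (f 1 ^+ 3 * f 5)).
Proof.
by apply: monic_seriesM; [|apply: monic_seriesV]; apply: monic_seriesM;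
  try apply: monic_seriesX; apply: f_monic.
Qed.

Lemma x_unit : x \is a GRing.unit.
Proof.
by rewrite unitrM lmono_unit/= monic_series_unit//; exact: x_cofactor_monic.
Qed.

Lemma x_lt1 n : n < 1 -> lcoef x n = 0.
Proof.
by move=> n1; rewrite [LHS]lmonoM (proj1 x_cofactor_monic)// subr_lt0.
Qed.

Lemma denominator_monic : monic_series (1 + 5 * x).
Proof.
have x5 n : n < 1 -> lcoef (5 * x) n = 0.
  move=> /x_lt1 xn.
  rewrite (_ : 5 * x = x + x + x + x + x); last by
    rewrite mulr_natl !mulrS mulr0n addr0 !addrA.
  by rewrite !lcoefD xn !addr0.
split=> [n n0|]; rewrite lcoefD lcoef1 x5 ?addr0 ?eqxx//; last lia.
by rewrite lt_eqF.
Qed.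

Lemma denominator_unit : 1 + 5 * x \is a GRing.unit.
Proof. exact: monic_series_unit denominator_monic. Qed.

(* Main.v *)
Require Import Defs.
From Stdlib Require Import ZArith.
From mathcomp Require Import all_boot all_order all_algebra.
From mathcomp Require Import all_classical.
From mathcomp Require Import zify ring ssrZ.
From HB Require Import structures.

(* Write [phi(q) = f_1^2 / f_2].  The Jacobi triple product gives Euler's
   pentagonal number theorem, [phi(q) = \sum_j (-1)^j q^(j^2)], and the product
   of the two theta series [\sum_j (-1)^j q^(5 j^2 - 4 j)] and
   [\sum_j (-1)^j q^(5 j^2 - 2 j)]; splitting [Z[i]] into classes modulo [2 + i]
   evaluates [phi(q)^2 - phi(q^5)^2] as [-4 q] times that product, whence
   [1 + 4 x = phi(q^5)^2 / phi(q)^2].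
   Put [T = x(q^5)].  Comparing residues modulo 5 of the exponents in
   [f_1^2 = phi f_2] shows that [sigma = phi(q) / phi(q^25)] is [1 + 2 d], where
   [d] is the root of a De Moivre quintic
   [d^5 + 5 g d^3 + 5 g^2 d + g + g^2 + 2 g^3 = 0] with [g = T / (1 + 4 T)].
   Since [(1 + 4 T) (1 + 4 x) sigma^2 = 1], separating even and odd powers of
   [sigma] yields the modular equation of degree 5 between [x] and [T], and
   [Phi = sigma^7 x^5 / (1 + g)^5].  So [U_5] of [x^i] and of [Phi x^i] follows from
   the traces of the powers of [sigma].
   In the modular equation and in the cofactor [Q] of [1 + 5 x], with
   [(1 + 5 x) Q = (1 + 5 T)^5], give [5], [T], [x] the weights [7], [-5], [-1]:
   every term of [Q] has weight at least 0 and every term of the expression of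
   [x^5] at least [-5], which propagates the bounds on the 5-adic valuations from
   finitely many initial values. *)

Set Implicit Arguments.
Unset Strict Implicit.
Unset Printing Implicit Defensive.

Import Order.TTheory GRing.Theory Num.Theory.
Local Open Scope classical_set_scope.
Local Open Scope ring_scope.
Local Delimit Scope Z_scope with BZ.

(** * Orders of vanishing *)

(** Coefficients stay in [int], so factors such as 2, [4^i] and 1024 can be cancelled but not
    inverted: identities are stated multiplied through by them. Infinite products are compared
    modulo [q^(M+1)] with finite ones, whose identities follow by induction on [M]. The use of
    [sigma] is that [U5] is linear over series in [q^5], while
    [4 (1 + 4 T) x = sigma^-2 - (1 + 4 T)]. Up to powers of 4 and series in [q^5], multiplying by
    [x] is thus a difference with step 2 in the exponent of [sigma], and one sequence, the traces of
    [sigma^(7 - j)], serves both operators: it starts at [j = 7] for [x^i] and at [j = 0] for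
    [Phi x^(i - 5)]. The constant term of the quintic, once scaled, is 1, so this sequence obeys a
    recurrence without denominators. Finally [1 + 5 x = (1 + 4 x) (1 + g0)] with
    [g0 = x / (1 + 4 x)], so [(1 + 5 x)^5] clears exactly the [(1 + g)^5] below [Phi]; this is the
    extra 5 in the exponent [5 n + 5]. *)

Definition vge (N : int) (a : laurent int) := forall n, n < N -> lcoef a n = 0.

Lemma lcoefN (a : laurent int) n : lcoef (- a) n = - lcoef a n.
Proof. by []. Qed.

Lemma lcoefB (a b : laurent int) n : lcoef (a - b) n = lcoef a n - lcoef b n.
Proof. by []. Qed.

Lemma lcoef_monoM k (a : laurent int) n :
  lcoef (lmono int k * a) n = lcoef a (n - k).
Proof. exact: lmonoM. Qed.

Lemma lmonoD k l : lmono int (k + l) = lmono int k * lmono int l.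
Proof.
by apply: laurentP => n; rewrite lcoef_monoM /= /lmono_coef; congr ((_ : bool)%:R); lia.
Qed.

Lemma lmono0 : lmono int 0 = 1. Proof. by []. Qed.

Lemma lmonoX k n : lmono int k ^+ n = lmono int (k * n).
Proof.
elim: n => [|n IH]; first by rewrite mulr0.
by rewrite exprS IH -lmonoD; congr lmono; lia.
Qed.

Lemma vgeD N a b : vge N a -> vge N b -> vge N (a + b).
Proof. by move=> ha hb n nN; rewrite lcoefD ha ?hb. Qed.

Lemma vgeN N a : vge N a -> vge N (- a).
Proof. by move=> ha n nN; rewrite lcoefN ha ?oppr0. Qed.

Lemma vgeB N a b : vge N a -> vge N b -> vge N (a - b).
Proof. by move=> ha hb; apply: vgeD => //; apply: vgeN. Qed.

Lemma vge_le M N a : M <= N -> vge N a -> vge M a.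
Proof. by move=> MN ha n nM; apply: ha; apply: lt_le_trans MN. Qed.

Lemma vge0 N : vge N 0. Proof. by []. Qed.

Lemma vge_sum N (I : Type) (s : seq I) (P : pred I) (F : I -> laurent int) :
  (forall i, P i -> vge N (F i)) -> vge N (\sum_(i <- s | P i) F i).
Proof.
by move=> h; apply: (big_ind (vge N)) => //; [exact: vgeD].
Qed.

Lemma vgeM N M a b : vge N a -> vge M b -> vge (N + M) (a * b).
Proof.
move=> ha hb n nNM; rewrite [LHS](@lmul_coefE _ a b n [::]) ?big_nil// => i /eqP[].
have [h|h] := ltP i N; first by rewrite ha ?mul0r.
by rewrite hb ?mulr0//; lia.
Qed.

Lemma vge_mono k : vge k (lmono int k).
Proof. by move=> n nk /=; rewrite /lmono_coef lt_eqF. Qed.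

Lemma vge1 : vge 0 1. Proof. exact: (@vge_mono 0). Qed.

Lemma vge_prod (I : Type) (s : seq I) (F : I -> laurent int) :
  (forall i, vge 0 (F i)) -> vge 0 (\prod_(i <- s) F i).
Proof.
move=> h; apply: (big_ind (vge 0)) => //; first exact: vge1.
by move=> a b ha hb; rewrite -[0]addr0; apply: vgeM.
Qed.

Lemma vge_subM N a a' b b' : vge 0 b -> vge 0 a' ->
  vge N (a - a') -> vge N (b - b') -> vge N (a * b - a' * b').
Proof.
move=> hb ha' haa hbb.
have -> : a * b - a' * b' = (a - a') * b + a' * (b - b') by ring.
apply: vgeD; first by rewrite -[N]addr0; apply: vgeM.
by rewrite -[N]add0r; apply: vgeM.
Qed.

Lemma vge_trans N a b c : vge N (a - b) -> vge N (b - c) -> vge N (a - c).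
Proof. by move=> ab bc; have := vgeD ab bc; rewrite addrA subrK. Qed.

Lemma vge_sym N a b : vge N (a - b) -> vge N (b - a).
Proof. by move=> /vgeN; rewrite opprB. Qed.

(** The passage to the limit: an identity between infinite products or sums follows from its
    truncations at arbitrarily high order. *)
Lemma vge_eq a b : (forall M : nat, exists2 N : int, M%:Z <= N & vge N (a - b)) -> a = b.
Proof.
move=> h; apply: laurentP => n; apply/eqP; rewrite -subr_eq0; apply/eqP.
have [N hN hv] := h `|n|.+1; rewrite -lcoefB; apply: hv; lia.
Qed.

Lemma vge_monicV N a b c : monic_series c -> vge N (c * (a - b)) -> vge N (a - b).
Proof.
move=> cm /(vgeM (proj1 (monic_seriesV cm))).
by rewrite add0r mulrA mulVr ?mul1r//; apply: monic_series_unit.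
Qed.

(** * Substitution of a power of q *)

Lemma Vsub_bound k (a : laurent int) :
  (fun n => if (k.+1 %| n)%Z then lcoef a (n %/ k.+1)%Z else 0) \in @bounded_below int.
Proof.
have [N aN] := lcoef_bound a.
apply/bounded_belowP; exists (- (N * k.+1)%N%:Z) => n nN.
case: ifP => // /dvdzP[m nE]; rewrite nE mulzK//; apply: aN; nia.
Qed.

(* [Vsub k] is [q |-> q^(k+1)]; the shift by one avoids the degenerate exponent 0. *)
Definition Vsub k a := Laurent (Vsub_bound k a).

Lemma lcoef_Vsub k a (n : int) : lcoef (Vsub k a) (k.+1%:Z * n) = lcoef a n.
Proof. by rewrite /= dvdz_mulr ?dvdzz// mulKz. Qed.

Lemma lcoef_Vsub0 k a (n : int) : ~~ (k.+1 %| n)%Z -> lcoef (Vsub k a) n = 0.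
Proof. by move=> h; rewrite /= (negPf h). Qed.

Lemma VsubP k a b :
  (forall n, ~~ (k.+1 %| n)%Z -> lcoef b n = 0) ->
  (forall n, lcoef b (k.+1%:Z * n) = lcoef a n) -> Vsub k a = b.
Proof.
move=> h0 h; apply: laurentP => n.
have [/dvdzP[m ->]|nd] := boolP (k.+1 %| n)%Z; last by rewrite lcoef_Vsub0 ?h0.
by rewrite mulrC lcoef_Vsub h.
Qed.

Lemma Vsub_additive k : zmod_morphism (Vsub k).
Proof.
move=> a b; apply: VsubP => n.
  by move=> nd; rewrite lcoefB !lcoef_Vsub0// subr0.
by rewrite lcoefB !lcoef_Vsub.
Qed.

Lemma Vsub1 k : Vsub k 1 = 1.
Proof.
apply: VsubP => n; rewrite !lcoef1; last by congr ((_ : bool)%:R); lia.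
by case: eqP => // ->; rewrite dvdz0.
Qed.

Lemma VsubM k a b : Vsub k (a * b) = Vsub k a * Vsub k b.
Proof.
have [N aN] := lcoef_bound a; have [M bM] := lcoef_bound b.
apply: VsubP => n.
  move=> nd; rewrite [LHS](@lmul_coefE _ _ _ n [::]) ?big_nil// => i /eqP[].
  have [id|id] := boolP (k.+1 %| i)%Z; last by rewrite lcoef_Vsub0 ?mul0r.
  rewrite [X in _ * X]lcoef_Vsub0 ?mulr0//; apply: contraNN nd => h.
  by rewrite -(subrK i n) rpredD.
set s := box (N + M + `|n|).
have sup i : lcoef a i * lcoef b (n - i) != 0 -> i \in s.
  apply: contraNT; rewrite mem_box => h.
  have [iN|iN] := ltP i (- N%:Z); first by rewrite aN ?mul0r.
  by rewrite bM ?mulr0//; lia.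
have inj : injective (fun i : int => k.+1%:Z * i) by apply: mulfI.
rewrite [RHS](@lmul_coefE _ a b n s) ?box_uniq//.
rewrite [LHS](@lmul_coefE _ _ _ _ [seq k.+1%:Z * i | i <- s]).
- by rewrite big_map; apply: eq_bigr => i _; rewrite -mulrBr !lcoef_Vsub.
- by rewrite map_inj_uniq ?box_uniq.
- move=> i; have [/dvdzP[j ->]|id] := boolP (k.+1 %| i)%Z; last first.
    by rewrite lcoef_Vsub0// mul0r eqxx.
  by rewrite [j * _]mulrC -mulrBr !lcoef_Vsub => /sup js; apply: map_f.
Qed.

HB.instance Definition _ k :=
  GRing.isZmodMorphism.Build (laurent int) (laurent int) (Vsub k) (Vsub_additive k).
HB.instance Definition _ k :=
  GRing.isMonoidMorphism.Build (laurent int) (laurent int) (Vsub k)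
    (Vsub1 k, @VsubM k).

Lemma Vsub_mono k n : Vsub k (lmono int n) = lmono int (k.+1%:Z * n).
Proof.
apply: VsubP => m; rewrite /= /lmono_coef; last by rewrite (inj_eq (mulfI _)).
by case: eqP => // ->; rewrite dvdz_mulr.
Qed.

Lemma Vsub_vge k N a : vge N a -> vge (k.+1%:Z * N) (Vsub k a).
Proof.
move=> ha n nN; have [/dvdzP[m nE]|nd] := boolP (k.+1 %| n)%Z; last by rewrite lcoef_Vsub0.
by move: nN; rewrite nE mulrC lcoef_Vsub => nN; apply: ha; nia.
Qed.

(** * Euler's function as a limit of finite products *)

Lemma prod_nat_recr1 (R : comNzRingType) M (F : nat -> R) :
  \prod_(1 <= j < M.+2) F j = (\prod_(1 <= j < M.+1) F j) * F M.+1.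
Proof. by rewrite big_nat_recr. Qed.

Definition eprod (r M : nat) : laurent int :=
  \prod_(1 <= j < M.+1) (1 - lmono int (r * j)%N).

Lemma vge_1Bmono (k : nat) : vge 0 (1 - lmono int k).
Proof. by apply: vgeB; [exact: vge1|apply: (vge_le _ (@vge_mono _))]. Qed.

Lemma vge_eprod r M : vge 0 (eprod r M).
Proof. by apply: vge_prod => j; apply: vge_1Bmono. Qed.

Lemma lcoef_eprod r M (n : nat) :
  lcoef (eprod r M) n = (\prod_(1 <= j < M.+1) (1 - 'X^(r * j)) : {poly int})`_n.
Proof.
rewrite /eprod; elim: M n => [|M IH] n.
  by rewrite !big_geq// lcoef1 coef1; congr ((_ : bool)%:R); lia.
rewrite !prod_nat_recr1 !mulrBr !mulr1 lcoefB coefB IH; congr (_ - _).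
rewrite mulrC lcoef_monoM coefMXn; case: ltnP => h; first by rewrite vge_eprod//; lia.
by rewrite subzn// IH.
Qed.

Lemma f_eprod r M : (0 < r)%N -> vge M.+1 (f r - eprod r M).
Proof.
move=> r0 [n|n] nM; rewrite lcoefB; last by rewrite vge_eprod.
by rewrite lcoef_eprod euler_coef_stable ?subrr.
Qed.

Lemma vge_f r : vge 0 (f r). Proof. by case. Qed.

Lemma Vsub_eprod k r M : Vsub k (eprod r M) = eprod (k.+1 * r) M.
Proof.
rewrite /eprod rmorph_prod; apply: eq_bigr => j _.
by rewrite rmorphB rmorph1 /= Vsub_mono; congr (_ - lmono _ _); lia.
Qed.

Lemma Vsub_f k r : (0 < r)%N -> Vsub k (f r) = f (k.+1 * r).
Proof.
move=> r0; apply: vge_eq => M; exists (M.+1%:Z); first by lia.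
have kr0 : (0 < k.+1 * r)%N by rewrite muln_gt0.
apply: vge_trans (vge_sym (@f_eprod _ M kr0)).
by rewrite -Vsub_eprod -rmorphB; apply: (vge_le _ (Vsub_vge (@f_eprod _ M r0))); nia.
Qed.

(** * Residue classes of exponents modulo 5 *)

Definition res (i : int) (a : laurent int) :=
  forall n, ~~ (5 %| n - i)%Z -> lcoef a n = 0.

Lemma resD i a b : res i a -> res i b -> res i (a + b).
Proof. by move=> ha hb n ni; rewrite lcoefD ha ?hb. Qed.

Lemma resN i a : res i a -> res i (- a).
Proof. by move=> ha n ni; rewrite lcoefN ha ?oppr0. Qed.

Lemma resM i j k a b : (5 %| i + j - k)%Z -> res i a -> res j b -> res k (a * b).
Proof.
move=> ijk ha hb n ni; rewrite [LHS](@lmul_coefE _ a b n [::]) ?big_nil// => m /eqP[].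
have [mi|mi] := boolP (5 %| m - i)%Z; last by rewrite ha ?mul0r.
by rewrite hb ?mulr0//; lia.
Qed.

Lemma res_mono i k : (5 %| k - i)%Z -> res i (lmono int k).
Proof.
by move=> ki n ni /=; rewrite /lmono_coef; case: eqP ni => // ->; rewrite ki.
Qed.

Lemma res_Vsub a : res 0 (Vsub 4 a).
Proof. by move=> n; rewrite subr0; exact: lcoef_Vsub0. Qed.

Lemma res_nat n : res 0 n%:R.
Proof. by rewrite -(rmorph_nat (Vsub 4)); exact: res_Vsub. Qed.

(** The five supports are disjoint. This is how one identity between series is turned into five. *)
Lemma res_eq0 a0 a1 a2 a3 a4 :
  res 0 a0 -> res 1 a1 -> res 2 a2 -> res 3 a3 -> res 4 a4 ->
  a0 + a1 + a2 + a3 + a4 = 0 ->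
  [/\ a0 = 0, a1 = 0, a2 = 0, a3 = 0 & a4 = 0].
Proof.
move=> h0 h1 h2 h3 h4 e.
have {}e n : lcoef a0 n + lcoef a1 n + lcoef a2 n + lcoef a3 n + lcoef a4 n = 0.
  by rewrite -!lcoefD e.
split; apply: laurentP => n; rewrite lcoef0.
- have [hn|hn] := boolP (5 %| n - 0)%Z; last exact: h0.
  by rewrite -(e n) h1 ?h2 ?h3 ?h4 ?addr0 ?add0r//; lia.
- have [hn|hn] := boolP (5 %| n - 1)%Z; last exact: h1.
  by rewrite -(e n) h0 ?h2 ?h3 ?h4 ?addr0 ?add0r//; lia.
- have [hn|hn] := boolP (5 %| n - 2)%Z; last exact: h2.
  by rewrite -(e n) h0 ?h1 ?h3 ?h4 ?addr0 ?add0r//; lia.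
- have [hn|hn] := boolP (5 %| n - 3)%Z; last exact: h3.
  by rewrite -(e n) h0 ?h1 ?h2 ?h4 ?addr0 ?add0r//; lia.
- have [hn|hn] := boolP (5 %| n - 4)%Z; last exact: h4.
  by rewrite -(e n) h0 ?h1 ?h2 ?h3 ?addr0 ?add0r//; lia.
Qed.

Lemma U5_res i a : ~~ (5 %| i)%Z -> res i a -> U5 a = 0.
Proof. by move=> i5 ha; apply: laurentP => n; rewrite [LHS]ha//; lia. Qed.

Lemma U5_additive : zmod_morphism U5.
Proof. by move=> a b; apply: laurentP => n. Qed.

HB.instance Definition _ :=
  GRing.isZmodMorphism.Build (laurent int) (laurent int) U5 U5_additive.

Lemma U5_Vsub a : U5 (Vsub 4 a) = a.
Proof. by apply: laurentP => n; rewrite -[RHS](lcoef_Vsub 4). Qed.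

(** Linearity over series in [q^5]; in particular a factor [x(q^5)] leaves [U5] as [x], on which all
    later recursions rest. *)
Lemma U5_VsubM a b : U5 (Vsub 4 a * b) = a * U5 b.
Proof.
apply: laurentP => n.
have [N aN] := lcoef_bound a; have [M bM] := lcoef_bound b.
set s := box (N + M + `|n|).
have inj : injective (fun i : int => 5 * i) by move=> i j; lia.
rewrite [RHS](@lmul_coefE _ a (U5 b) n s) ?box_uniq//; last first.
  move=> i; apply: contraNT; rewrite mem_box => h.
  have [iN|iN] := ltP i (- N%:Z); first by rewrite aN ?mul0r.
  by rewrite /= bM ?mulr0//; lia.
rewrite [LHS](@lmul_coefE _ _ _ _ [seq 5 * i | i <- s]).
- by rewrite big_map; apply: eq_bigr => i _; rewrite -[in RHS](lcoef_Vsub 4) /= mulrBr.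
- by rewrite map_inj_uniq ?box_uniq.
- move=> i; have [/dvdzP[j ->]|id] := boolP (5 %| i)%Z; last first.
    by rewrite (@lcoef_Vsub0 4)// mul0r eqxx.
  rewrite [j * _]mulrC (@lcoef_Vsub 4) => h; apply: map_f; move: h; apply: contraNT.
  rewrite mem_box => h.
  have [iN|iN] := ltP j (- N%:Z); first by rewrite aN ?mul0r.
  by rewrite bM ?mulr0//; lia.
Qed.

(** * Generating functions of weighted index sets *)

Lemma lcoef_intM (z : int) (a : laurent int) n :
  lcoef (z%:~R * a) n = z * lcoef a n.
Proof.
have natM (k : nat) : lcoef (k%:R * a) n = k%:R * lcoef a n.
  elim: k => [|k IH]; first by rewrite !mul0r.
  by rewrite -natr1 mulrDl mul1r lcoefD IH -natr1; ring.
case: z => k; first by rewrite -pmulrn natM natz.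
by rewrite NegzE mulrNz mulNr lcoefN -pmulrn natM natz mulNr.
Qed.

Lemma lcoef_sum (I : Type) (s : seq I) (P : pred I) (F : I -> laurent int) n :
  lcoef (\sum_(i <- s | P i) F i) n = \sum_(i <- s | P i) lcoef (F i) n.
Proof. exact: (big_morph (fun a => lcoef a n) (fun a b => lcoefD a b n)). Qed.

(** The value 0 at negative [n] makes this a Laurent series for every [w]; the weights used below
    are nonnegative, so nothing is lost. *)
Definition gcoef (I : choiceType) (w e : I -> int) (n : int) : int :=
  if n < 0 then 0 else \sum_(i \in [set i | w i = n]) e i.

Lemma gcoef_bound (I : choiceType) (w e : I -> int) :
  gcoef w e \in @bounded_below int.
Proof. by apply/bounded_belowP; exists 0 => n n0; rewrite /gcoef n0. Qed.

(* The series [\sum_i e i * q^(w i)], meaningful when [w] is locally finite. *)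
Definition gsum (I : choiceType) (w e : I -> int) := Laurent (gcoef_bound w e).

Definition locfin (I : choiceType) (w : I -> int) :=
  (forall i, 0 <= w i) /\
  forall n, exists2 s : seq I, uniq s & forall i, w i <= n -> i \in s.

Lemma gsumE (I : choiceType) (w e : I -> int) n (s : seq I) :
  (forall i, 0 <= w i) -> uniq s -> (forall i, w i = n -> i \in s) ->
  lcoef (gsum w e) n = \sum_(i <- s | w i == n) e i.
Proof.
move=> w0 us hs; rewrite /= /gcoef; case: ltP => n0.
  by rewrite big_pred0// => i; apply/negP => /eqP wi; have := w0 i; lia.
rewrite (fsbigE [seq i <- s | w i == n]) ?filter_uniq//.
- rewrite big_filter_cond; apply: eq_bigl => i; apply/andP/eqP => [[/eqP]//|wi].
  by rewrite inE wi.
- by move=> i /=; rewrite mem_filter => /andP[/eqP].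
- by move=> i wi; rewrite mem_filter wi eqxx hs.
Qed.

Lemma vge_gsum (I : choiceType) (w e : I -> int) : vge 0 (gsum w e).
Proof. by move=> n n0; rewrite /= /gcoef n0. Qed.

Lemma gsum_ext (I : choiceType) (w w' e e' : I -> int) :
  w =1 w' -> e =1 e' -> gsum w e = gsum w' e'.
Proof. by move=> /funext -> /funext ->. Qed.

Lemma gsumM (I J : choiceType) (w e : I -> int) (w' e' : J -> int) :
  locfin w -> locfin w' ->
  gsum w e * gsum w' e' =
  gsum (fun ij : I * J => w ij.1 + w' ij.2) (fun ij => e ij.1 * e' ij.2).
Proof.
move=> [w0 wf] [w'0 w'f]; apply: laurentP => n.
have [n0|] := ltP n 0.
  rewrite [RHS]vge_gsum//; apply: lcoefM_lt0 => // m m0; exact: vge_gsum.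
case: n => // n _.
have [s us hs] := wf n; have [s' us' hs'] := w'f n.
rewrite lcoefM_series; try exact: vge_gsum.
rewrite (@gsumE _ _ _ _ ([seq (i, j) | i <- s, j <- s'])); last first.
- by case=> i j /= ij; apply/allpairsP; exists (i, j); split => //;
    [apply: hs|apply: hs'] => /=; have := w0 i; have := w'0 j; lia.
- by apply: allpairs_uniq => // -[? ?] [? ?].
- by case=> i j /=; apply: addr_ge0.
transitivity (\sum_(k < n.+1) \sum_(i <- s) \sum_(j <- s')
    (if (w i == k) && (w' j == (n - k)%N) then e i * e' j else 0)).
  apply: eq_bigr => k _.
  rewrite (@gsumE _ _ _ _ s)//; last by move=> i wi; apply: hs; have := ltn_ord k; lia.
  rewrite (@gsumE _ _ _ _ s')//; last by move=> i wi; apply: hs'; lia.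
  rewrite mulr_suml big_mkcond; apply: eq_bigr => i _.
  case: eqP => wi /=; last by rewrite big1.
  by rewrite mulr_sumr big_mkcond; apply: eq_bigr => j _.
rewrite [RHS]big_mkcond [RHS]big_allpairs exchange_big; apply: eq_bigr => i _.
rewrite exchange_big; apply: eq_bigr => j _ /=.
have := w0 i; have := w'0 j.
case: eqP => [wn w'j wi|wn w'j wi].
  have kn : (absz (w i) < n.+1)%N by lia.
  rewrite (bigD1 (Ordinal kn))//= ifT; last by lia.
  rewrite big1 ?addr0// => k /eqP nk; rewrite ifF//; apply/negP => /andP[/eqP h _].
  by apply: nk; apply: val_inj; rewrite /= h.
rewrite big1// => k _; rewrite ifF//; apply/negP => /andP[/eqP h /eqP h'].
by apply: wn; have := ltn_ord k; lia.
Qed.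

Lemma gsum_class (I : choiceType) (F : finType) (w e : I -> int) (cls : I -> F) :
  locfin w ->
  gsum w e = \sum_f gsum w (fun i => if cls i == f then e i else 0).
Proof.
move=> [w0 wf]; apply: laurentP => n; rewrite lcoef_sum.
have [s us hs] := wf n.
have hs' i : w i = n -> i \in s by move=> wi; apply: hs; rewrite wi.
rewrite (gsumE _ w0 us hs') (eq_bigr _ (fun f _ => gsumE _ w0 us hs')).
rewrite exchange_big; apply: eq_bigr => i _.
by rewrite -big_mkcond (big_pred1 (cls i)).
Qed.

Lemma gsum_reindex (I K : choiceType) (w e : I -> int) (h : K -> I) :
  injective h -> (forall i, e i != 0 -> exists k, i = h k) ->
  gsum w e = gsum (fun k => w (h k)) (fun k => e (h k)).
Proof.
move=> hinj hsurj; apply: laurentP => n /=; rewrite /gcoef; case: ltP => // n0.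
rewrite -(@fsbig_image _ _ _ _ _ [set k | w (h k) = n] h); last by move=> ? ? _ _ /hinj.
symmetry; apply: fsbig_widen => [i [k /= wk <-]//|i /= [wi nh]].
apply/eqP/negPn/negP => /hsurj[k ik]; apply: nh; exists k => //=.
by rewrite -ik.
Qed.

Lemma gsum_shift (I : choiceType) (w e : I -> int) (k : nat) :
  (forall i, 0 <= w i) -> gsum (fun i => k%:Z + w i) e = lmono int k * gsum w e.
Proof.
move=> w0; apply: laurentP => n; rewrite lcoef_monoM /= /gcoef.
case: ltP => n0.
  by case: ltP => n1 //; rewrite (_ : [set i | _] = set0) ?fsbig_set0// -subset0 => i /=; lia.
have -> : [set i | k%:Z + w i = n] = [set i | w i = n - k%:Z] by apply/seteqP; split => i /=; lia.
by case: ltP => // n1; rewrite (_ : [set i | _] = set0) ?fsbig_set0// -subset0 => i /=; have := w0 i; lia.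
Qed.

Lemma gsum_scale (I : choiceType) (w e : I -> int) (c : int) :
  gsum w (fun i => c * e i) = c%:~R * gsum w e.
Proof.
apply: laurentP => n; rewrite lcoef_intM /= /gcoef; case: ltP => _; first by rewrite mulr0.
have [->|c0] := eqVneq c 0; last by rewrite mulr_fsumr.
by rewrite mul0r fsbig1// => i _; rewrite mul0r.
Qed.

Lemma Vsub_gsum (I : choiceType) (w e : I -> int) k :
  Vsub k (gsum w e) = gsum (fun i => k.+1%:Z * w i) e.
Proof.
apply: VsubP => n.
  move=> nd /=; rewrite /gcoef; case: ltP => // _.
  rewrite (_ : [set i | _] = set0) ?fsbig_set0// -subset0 => i /= wi.
  by rewrite -wi dvdz_mulr in nd.
rewrite /= /gcoef pmulr_rlt0//; case: ltP => // _; congr (\sum_(i \in _) _).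
by apply/seteqP; split => i /= => [/mulfI->|->].
Qed.

(** * The Jacobi triple product *)

(** Gaussian binomial coefficients, through the q-Pascal rule so that no division occurs. *)
Fixpoint qbin (R : comNzRingType) (Q : R) (n k : nat) : R :=
  match n, k with
  | _, 0 => 1
  | 0, _.+1 => 0
  | n'.+1, k'.+1 => qbin Q n' k' + Q ^+ k * qbin Q n' k
  end.

Lemma qbinS (R : comNzRingType) (Q : R) n k :
  qbin Q n.+1 k.+1 = qbin Q n k + Q ^+ k.+1 * qbin Q n k.+1.
Proof. by []. Qed.

Lemma qbin0 (R : comNzRingType) (Q : R) n : qbin Q n 0 = 1.
Proof. by case: n. Qed.

Lemma qbin_small (R : comNzRingType) (Q : R) n k : (n < k)%N -> qbin Q n k = 0.
Proof.
elim: n k => [|n IH] [|k]// nk.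
by rewrite qbinS !IH ?mulr0 ?addr0//; lia.
Qed.

Definition qpoch (R : comNzRingType) (Q : R) n := \prod_(1 <= i < n.+1) (1 - Q ^+ i).

Lemma qpochS (R : comNzRingType) (Q : R) n :
  qpoch Q n.+1 = qpoch Q n * (1 - Q ^+ n.+1).
Proof. exact: prod_nat_recr1. Qed.

Lemma qpoch0 (R : comNzRingType) (Q : R) : qpoch Q 0 = 1.
Proof. by rewrite /qpoch big_geq. Qed.

Lemma qbin_qpoch (R : comNzRingType) (Q : R) n k : (k <= n)%N ->
  qbin Q n k * qpoch Q k * qpoch Q (n - k) = qpoch Q n.
Proof.
elim: n k => [|n IH] [|k] kn.
- by rewrite qpoch0 !mul1r.
- by [].
- by rewrite qbin0 qpoch0 subn0 !mul1r.
- have IH1 := IH k kn; rewrite subSS qbinS.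
  have E1 : qbin Q n k * qpoch Q k.+1 * qpoch Q (n - k) = qpoch Q n * (1 - Q ^+ k.+1).
    by rewrite qpochS -IH1; ring.
  suff E2 : qbin Q n k.+1 * qpoch Q k.+1 * qpoch Q (n - k) = qpoch Q n * (1 - Q ^+ (n - k)).
    rewrite [qpoch Q n.+1]qpochS.
    have -> : (qbin Q n k + Q ^+ k.+1 * qbin Q n k.+1) * qpoch Q k.+1 * qpoch Q (n - k) =
        qbin Q n k * qpoch Q k.+1 * qpoch Q (n - k) +
        Q ^+ k.+1 * (qbin Q n k.+1 * qpoch Q k.+1 * qpoch Q (n - k)) by ring.
    rewrite E1 E2.
    have -> : Q ^+ n.+1 = Q ^+ k.+1 * Q ^+ (n - k) by rewrite -exprD; congr (_ ^+ _); lia.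
    by ring.
  have [kn'|nk] := ltnP k n; last first.
    have -> : k = n by lia.
    by rewrite qbin_small// subnn expr0 subrr mulr0 !mul0r.
  have -> : (n - k = (n - k.+1).+1)%N by lia.
  by rewrite [qpoch Q (n - k.+1).+1]qpochS -(IH k.+1 kn'); ring.
Qed.

(** Rothe's q-binomial theorem: split off the factor at [i = 0] and apply the induction hypothesis
    to [t * Q]. *)
Lemma qbinomial (R : comNzRingType) (Q t : R) n :
  \prod_(i < n) (1 + t * Q ^+ i) =
  \sum_(k < n.+1) Q ^+ 'C(k, 2) * qbin Q n k * t ^+ k.
Proof.
elim: n t => [|n IH] t.
  by rewrite big_ord0 big_ord1 qbin0 !mulr1.
rewrite big_ord_recl expr0 mulr1.
rewrite (eq_bigr (fun i : 'I_n => 1 + t * Q * Q ^+ i)); last first.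
  by move=> i _; rewrite /= exprS mulrA.
rewrite IH mulrDl mul1r mulr_sumr [in RHS]big_ord_recl qbin0.
rewrite [X in X + _ = _]big_ord_recl qbin0 -addrA; congr (_ + _).
rewrite [RHS](eq_bigr (fun k : 'I_n.+1 =>
    Q ^+ 'C(k.+1, 2) * qbin Q n k.+1 * (t * Q) ^+ k.+1 +
    t * (Q ^+ 'C(k, 2) * qbin Q n k * (t * Q) ^+ k))); last first.
  move=> k _; rewrite lift0 qbinS binS bin1 !exprMn exprD !exprS; ring.
rewrite big_split; congr (_ + _).
rewrite [RHS]big_ord_recr /= qbin_small// mulr0 mul0r addr0.
by apply: eq_bigr => k _; rewrite /bump /= add1n.
Qed.

Definition sgn (j : int) : int := (-1) ^+ `|j|%N.

Definition tri (j : int) : int := (j * (j - 1) %/ 2)%Z.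

Lemma tri2 j : tri j * 2 = j * j - j.
Proof.
rewrite /tri divzK; first by ring.
have [h|h] : (2 %| j)%Z \/ (2 %| j - 1)%Z by lia.
  exact: dvdz_mulr.
exact: dvdz_mull.
Qed.

Definition tw (c e : nat) (j : int) : int := c%:Z * tri j + e%:Z * j.

(** For [j >= 0] both [tri j] and [e - 1] are nonnegative; for [j < 0] write the weight as
    [c (tri j + j) + (c - e) (- j)]. The bound gives local finiteness and controls the truncation
    error in [jtp]. *)
Lemma tw_ge c e j : (0 < e < c)%N -> `|j| <= tw c e j.
Proof.
move=> /andP[e0 ec]; rewrite /tw; have := tri2 j; set t := tri j => tE.
have [j0|j0] := lerP 0 j.
  have t0 : 0 <= t by have [j1|j1] := lerP j 0; nia.
  have := mulr_ge0 (ler0n int c) t0; have e1 : 0 <= e%:Z - 1 by lia.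
  by have := mulr_ge0 e1 j0; rewrite natz mulrBl mul1r; lia.
have t0 : 0 <= t + j by nia.
have := mulr_ge0 (ler0n int c) t0; have e1 : 0 <= c%:Z - e%:Z - 1 by lia.
have j1 : 0 <= - j by lia.
by have := mulr_ge0 e1 j1; rewrite natz mulrDr !mulrBl !mulrN mul1r; lia.
Qed.

Lemma tw_locfin c e : (0 < e < c)%N -> locfin (tw c e).
Proof.
move=> ec; split=> [i|n]; first by apply: le_trans (tw_ge i ec).
exists (box `|n|); first exact: box_uniq.
by move=> i; rewrite mem_box => h; have := tw_ge i ec; lia.
Qed.

Definition theta (c e : nat) := gsum (tw c e) sgn.

Lemma prod_neg_mono (c e M : nat) :
  \prod_(1 <= j < M.+1) - lmono int (c%:Z * j%:Z - e%:Z) =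
  (-1) ^+ M * lmono int (c%:Z * 'C(M.+1, 2)%:Z - e%:Z * M%:Z).
Proof.
elim: M => [|M IH]; first by rewrite big_geq// mul1r bin_small// !mulr0 subr0 lmono0.
rewrite prod_nat_recr1 IH mulrN -mulrA -lmonoD exprS mulN1r mulNr; congr (- (_ * lmono _ _)).
by rewrite [in RHS]binS bin1; lia.
Qed.

Lemma tw_shift (c e k M : nat) :
  tw c e (k%:Z - M%:Z) =
  c%:Z * 'C(M.+1, 2)%:Z - e%:Z * M%:Z + (c%:Z * 'C(k, 2)%:Z + (e%:Z - c%:Z * M%:Z) * k%:Z).
Proof.
have binE n : 'C(n, 2)%:Z * 2 = n%:Z * n%:Z - n%:Z.
  elim: n => // n IH; rewrite binS bin1; lia.
have := binE k; have := binE M.+1; have := tri2 (k%:Z - M%:Z); rewrite /tw.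
set t := tri _; set a := 'C(M.+1, 2)%:Z; set b := 'C(k, 2)%:Z => h1 h2 h3.
have -> : t = a + b - M%:Z * k%:Z by lia.
by ring.
Qed.

Lemma sgnB (k M : nat) : (sgn (k%:Z - M%:Z))%:~R = (-1) ^+ M * (-1) ^+ k :> laurent int.
Proof.
rewrite /sgn rmorphXn rmorphN1 -exprD -[LHS]signr_odd -[RHS]signr_odd.
by have -> : odd `|k%:Z - M%:Z| = odd (M + k) by lia.
Qed.

(** Extracting [- lmono int (c j - e)] from the first factor of each pair leaves [2 M] consecutive
    factors [1 + t Q^i], so the q-binomial theorem applies; its index is then centred by subtracting
    [M]. *)
Lemma jtp_finite (c e M : nat) :
  \prod_(1 <= j < M.+1) ((1 - lmono int (c%:Z * j%:Z - e%:Z)) *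
                         (1 - lmono int (c%:Z * j%:Z - c%:Z + e%:Z))) =
  \sum_(k < (M + M).+1) (sgn (k%:Z - M%:Z))%:~R * lmono int (tw c e (k%:Z - M%:Z)) *
     qbin (lmono int c) (M + M) k.
Proof.
set t := - lmono int (e%:Z - c%:Z * M%:Z); set Q := lmono int c.
have E : \prod_(1 <= j < M.+1) ((1 - lmono int (c%:Z * j%:Z - e%:Z)) *
                         (1 - lmono int (c%:Z * j%:Z - c%:Z + e%:Z))) =
    (\prod_(1 <= j < M.+1) - lmono int (c%:Z * j%:Z - e%:Z)) *
    \prod_(i < M + M) (1 + t * Q ^+ i).
  rewrite big_split_ord big_split mulrA; congr (_ * _).
    transitivity ((\prod_(1 <= j < M.+1) - lmono int (c%:Z * j%:Z - e%:Z)) *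
                  \prod_(1 <= j < M.+1) (1 - lmono int (e%:Z - c%:Z * j%:Z))).
      rewrite -big_split; apply: eq_big_nat => j _ /=.
      rewrite mulNr mulrBr mulr1 -lmonoD.
      by rewrite -[e%:Z - c%:Z * j%:Z]opprB subrr lmono0 opprB.
    congr (_ * _); rewrite big_add1 /= big_mkord.
    rewrite -(big_mkord xpredT (fun i => 1 + t * Q ^+ i)) big_nat_rev big_mkord.
    apply: eq_bigr => j _; rewrite /t /Q lmonoX mulNr -lmonoD; congr (1 - lmono _ _).
    by have := ltn_ord j; rewrite add0n => jM; rewrite -subzn//; ring.
  rewrite big_add1 big_mkord; apply: eq_bigr => i _.
  rewrite /t /Q lmonoX mulNr -lmonoD; congr (1 - lmono _ _).
  by rewrite /=; lia.
rewrite E prod_neg_mono qbinomial mulr_sumr; apply: eq_bigr => k _.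
rewrite sgnB tw_shift /Q /t (exprNn (lmono int (e%:Z - c%:Z * M%:Z))) (lmonoX c%:Z) (lmonoX (e%:Z - c%:Z * M%:Z)).
rewrite (lmonoD (c%:Z * 'C(M.+1, 2)%:Z - e%:Z * M%:Z)) (lmonoD (c%:Z * 'C(k, 2)%:Z)).
ring.
Qed.

Lemma eprod_qpoch (c M : nat) : eprod c M = qpoch (lmono int c) M.
Proof. by apply: eq_bigr => j _; rewrite lmonoX. Qed.

Lemma vge_qbin (c n k : nat) : vge 0 (qbin (lmono int c) n k).
Proof.
elim: n k => [|n IH] [|k]; try by [exact: vge1|exact: vge0].
rewrite qbinS; apply: vgeD => //; rewrite lmonoX -[0]addr0.
by apply: vgeM => //; apply: vge_le (@vge_mono _).
Qed.

(** The Gaussian binomial is a quotient of three finite products of lengths [2 M], [k] and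
    [2 M - k], each congruent to [f c] modulo [q^(m+1)]; hence [b * f c] is congruent to 1. *)
Lemma qbin_lim (c M k m : nat) : (0 < c)%N -> (k <= M + M)%N -> (m <= k)%N ->
  (m <= M + M - k)%N ->
  vge m.+1 (qbin (lmono int c) (M + M) k * eprod c M - 1).
Proof.
move=> c0 kM mk mMk; set b := qbin _ _ _.
have b0 : vge 0 b by apply: vge_qbin.
have P n : (m <= n)%N -> vge m.+1 (f c - eprod c n).
  by move=> mn; apply: vge_le (@f_eprod _ n c0); lia.
have bF : vge m.+1 (b * f c - 1).
  apply: (vge_monicV (f_monic c0)); rewrite mulrBr mulr1.
  apply: (@vge_trans _ _ (eprod c (M + M))); last by apply/vge_sym/P; lia.
  rewrite eprod_qpoch -(@qbin_qpoch _ (lmono int c) (M + M) k)// -!eprod_qpoch -/b.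
  rewrite mulrA; apply: vge_subM; last by apply: P.
  - exact: vge_f.
  - by rewrite -[0]addr0; apply: vgeM => //; exact: vge_eprod.
  - rewrite mulrC; apply: vge_subM => //; last by apply: P.
    - exact: vge_f.
    - by rewrite subrr; exact: vge0.
apply: vge_trans bF; rewrite -mulrBr -[m.+1%:Z]add0r; apply: vgeM => //.
by apply: vge_sym; apply: P; lia.
Qed.

Lemma theta_trunc (c e M : nat) : (0 < e < c)%N ->
  vge M.+1 (theta c e - \sum_(j <- box M) (sgn j)%:~R * lmono int (tw c e j)).
Proof.
move=> ec n nM; rewrite lcoefB lcoef_sum.
rewrite (@gsumE _ _ _ _ (box M)) ?box_uniq//.
- rewrite big_mkcond -sumrB big1// => j _.
  rewrite lcoef_intM /= /lmono_coef eq_sym; case: eqP; rewrite ?mulr1 ?mulr0 subrr//.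
- exact: (proj1 (tw_locfin ec)).
- by move=> i wi; rewrite mem_box; have := tw_ge i ec; lia.
Qed.

(* The [j]-th term is off by a series of order [M - |j| + 1]; as [|j| <= tw c e j],
   the total error has order at least [M + 1]. *)
Lemma jtp (c e M : nat) : (0 < e < c)%N ->
  vge M.+1 (theta c e -
    eprod c M * \prod_(1 <= j < M.+1) ((1 - lmono int (c%:Z * j%:Z - e%:Z)) *
                         (1 - lmono int (c%:Z * j%:Z - c%:Z + e%:Z)))).
Proof.
move=> ec; apply: (vge_trans (@theta_trunc _ _ M ec)).
rewrite jtp_finite /box big_map -[iota _ _]/(index_iota 0 (M + M).+1) big_mkord.
rewrite mulr_sumr -sumrB; apply: vge_sum => k _.
set j := k%:Z - M%:Z; set s := (sgn j)%:~R; set b := qbin _ _ _.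
have -> : s * lmono int (tw c e j) - eprod c M * (s * lmono int (tw c e j) * b) =
  s * (lmono int (tw c e j) * (- (b * eprod c M - 1))) by ring.
move=> n nM; rewrite lcoef_intM.
have kM := ltn_ord k.
have := @qbin_lim c M k (minn k (M + M - k)) _ _ _ _.
rewrite -/b => /(_ _ _ _ _)/vgeN h.
rewrite (vgeM (@vge_mono _) (h _ _ _ _)) ?mulr0//; try lia.
by have := tw_ge j ec; rewrite /j; lia.
Qed.

Lemma eprodS r M : eprod r M.+1 = eprod r M * (1 - lmono int (r%:Z * M%:Z + r%:Z)).
Proof.
rewrite /eprod prod_nat_recr1.
by have -> : (r * M.+1)%N%:Z = r%:Z * M%:Z + r%:Z by lia.
Qed.

Definition jprod (c e M : nat) : laurent int :=
  \prod_(1 <= j < M.+1) ((1 - lmono int (c%:Z * j%:Z - e%:Z)) *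
                         (1 - lmono int (c%:Z * j%:Z - c%:Z + e%:Z))).

Lemma jprodS (c e M : nat) : jprod c e M.+1 = jprod c e M *
  ((1 - lmono int (c%:Z * M%:Z + c%:Z - e%:Z)) * (1 - lmono int (c%:Z * M%:Z + e%:Z))).
Proof.
rewrite /jprod prod_nat_recr1.
have -> : c%:Z * M.+1%:Z - e%:Z = c%:Z * M%:Z + c%:Z - e%:Z by lia.
by have -> : c%:Z * M.+1%:Z - c%:Z + e%:Z = c%:Z * M%:Z + e%:Z by lia.
Qed.

Lemma prod_geq0 (F : nat -> laurent int) : \prod_(1 <= j < 1) F j = 1.
Proof. by rewrite big_geq. Qed.

Lemma vge_theta c e : vge 0 (theta c e).
Proof. exact: vge_gsum. Qed.

Lemma vge0M a b : vge 0 a -> vge 0 b -> vge 0 (a * b).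
Proof. by move=> ha hb; rewrite -[0]addr0; apply: vgeM. Qed.

Lemma vge_jprod c e M : (0 < e < c)%N -> vge 0 (jprod c e M).
Proof.
move=> ec; rewrite /jprod big_nat; apply: (big_ind (vge 0)).
- exact: vge1.
- by move=> a b; apply: vge0M.
- move=> j /andP[j1 jM]; apply: vge0M; apply: vgeB; try exact: vge1;
    apply: vge_le (@vge_mono _); nia.
Qed.

Lemma vge_exp a n : vge 0 a -> vge 0 (a ^+ n).
Proof.
by move=> ha; elim: n => [|n IH]; rewrite ?expr0 ?exprS; [exact: vge1|exact: vge0M].
Qed.

Lemma vge_subX N a a' n : vge 0 a -> vge 0 a' -> vge N (a - a') ->
  vge N (a ^+ n - a' ^+ n).
Proof.
move=> ha ha' h; elim: n => [|n IH]; first by rewrite !expr0 subrr; exact: vge0.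
by rewrite !exprS; apply: vge_subM => //; apply: vge_exp.
Qed.

(** The exponents [3 j], [3 j - 1], [3 j - 2] of the triple product run once through all positive
    integers. *)
Lemma euler_pentagonal : f 1 = theta 3 1.
Proof.
apply: vge_eq => M; exists M.+1%:Z; first by lia.
have E : eprod 3 M * jprod 3 1 M = eprod 1 (3 * M).
  elim: M => [|M IH]; first by rewrite /jprod /eprod !prod_geq0 mulr1.
  rewrite mulnS /= !eprodS -IH jprodS.
  have -> : 1%N%:Z * (3 * M)%N.+1%:Z + 1%N%:Z = 3%N%:Z * M%:Z + 3%N%:Z - 1%N%:Z by lia.
  have -> : 1%N%:Z * (3 * M)%N.+2%:Z + 1%N%:Z = 3%N%:Z * M%:Z + 3%N%:Z by lia.
  have -> : 1%N%:Z * (3 * M)%N%:Z + 1%N%:Z = 3%N%:Z * M%:Z + 1%N%:Z by lia.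
  by ring.
apply: (@vge_trans _ _ (eprod 1 (3 * M))).
  by apply: vge_le (@f_eprod 1 (3 * M) _); lia.
by rewrite -E; apply: vge_sym; apply: jtp.
Qed.

(** The odd exponents occur twice in the triple product and the even ones once; [f 2] supplies the
    second copy of the even ones. *)
Lemma gauss_square : theta 2 1 * f 2 = f 1 ^+ 2.
Proof.
apply: vge_eq => M; exists M.+1%:Z; first by lia.
have E : eprod 2 M * jprod 2 1 M * eprod 2 M = eprod 1 (2 * M) ^+ 2.
  elim: M => [|M IH]; first by rewrite /jprod /eprod !prod_geq0 !mulr1 expr1n.
  rewrite mulnS /= !eprodS !exprMn -IH jprodS.
  have -> : 1%N%:Z * (2 * M)%N.+1%:Z + 1%N%:Z = 2%N%:Z * M%:Z + 2%N%:Z by lia.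
  have -> : 1%N%:Z * (2 * M)%N%:Z + 1%N%:Z = 2%N%:Z * M%:Z + 1%N%:Z by lia.
  have -> : 2%N%:Z * M%:Z + 2%N%:Z - 1%N%:Z = 2%N%:Z * M%:Z + 1%N%:Z by lia.
  by ring.
apply: (@vge_trans _ _ (eprod 1 (2 * M) ^+ 2)).
  rewrite -E; apply: vge_subM; last by apply: f_eprod.
  - exact: vge_f.
  - by apply: vge0M; [exact: vge_eprod|exact: vge_jprod].
  - exact: jtp.
apply: vge_sym; apply: vge_subX; first exact: vge_f.
  exact: vge_eprod.
by apply: vge_le (@f_eprod 1 (2 * M) _); lia.
Qed.

(** The theta series supply the exponents prime to 10 and two factors [f 10]; [f 2] supplies the
    even exponents, and [f 5] the odd multiples of 5 and a third [f 10]. *)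
Lemma theta10_prod : theta 10 1 * theta 10 3 * f 2 * f 5 = f 1 * f 10 ^+ 3.
Proof.
apply: vge_eq => M; exists M.+1%:Z; first by lia.
have E : eprod 10 M * jprod 10 1 M * (eprod 10 M * jprod 10 3 M) *
    eprod 2 (5 * M) * eprod 5 (2 * M) = eprod 1 (10 * M) * eprod 10 M ^+ 3.
  elim: M => [|M IH]; first by rewrite /jprod /eprod !prod_geq0 expr1n !mulr1.
  rewrite !mulnS /= !eprodS !exprMn !jprodS.
  have -> : 1%N%:Z * (10 * M)%N%:Z + 1%N%:Z = 10%N%:Z * M%:Z + 1%N%:Z by lia.
  have -> : 1%N%:Z * (10 * M)%N.+1%:Z + 1%N%:Z = 2%N%:Z * (5 * M)%N%:Z + 2%N%:Z by lia.
  have -> : 1%N%:Z * (10 * M)%N.+2%:Z + 1%N%:Z = 10%N%:Z * M%:Z + 3%N%:Z by lia.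
  have -> : 1%N%:Z * (10 * M)%N.+3%:Z + 1%N%:Z = 2%N%:Z * (5 * M)%N.+1%:Z + 2%N%:Z by lia.
  have -> : 1%N%:Z * (10 * M)%N.+4%:Z + 1%N%:Z = 5%N%:Z * (2 * M)%N%:Z + 5%N%:Z by lia.
  have -> : 1%N%:Z * (10 * M)%N.+4.+1%:Z + 1%N%:Z = 2%N%:Z * (5 * M)%N.+2%:Z + 2%N%:Z by lia.
  have -> : 1%N%:Z * (10 * M)%N.+4.+2%:Z + 1%N%:Z = 10%N%:Z * M%:Z + 10%N%:Z - 3%N%:Z by lia.
  have -> : 1%N%:Z * (10 * M)%N.+4.+3%:Z + 1%N%:Z = 2%N%:Z * (5 * M)%N.+3%:Z + 2%N%:Z by lia.
  have -> : 1%N%:Z * (10 * M)%N.+4.+4%:Z + 1%N%:Z = 10%N%:Z * M%:Z + 10%N%:Z - 1%N%:Z by lia.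
  have -> : 1%N%:Z * (10 * M)%N.+4.+4.+1%:Z + 1%N%:Z = 10%N%:Z * M%:Z + 10%N%:Z by lia.
  have -> : 2%N%:Z * (5 * M)%N.+4%:Z + 2%N%:Z = 10%N%:Z * M%:Z + 10%N%:Z by lia.
  have -> : 5%N%:Z * (2 * M)%N.+1%:Z + 5%N%:Z = 10%N%:Z * M%:Z + 10%N%:Z by lia.
  move: IH; move: (eprod 1 _) (eprod 10 M) (eprod 2 _) (eprod 5 _) (jprod 10 1 M) (jprod 10 3 M).
  move=> A B C D J K IH.
  move: (lmono int (10%N%:Z * M%:Z + 1%N%:Z)) => y0.
  move: (lmono int (2%N%:Z * (5 * M)%N%:Z + 2%N%:Z)) => y1.
  move: (lmono int (10%N%:Z * M%:Z + 3%N%:Z)) => y2.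
  move: (lmono int (2%N%:Z * (5 * M)%N.+1%:Z + 2%N%:Z)) => y3.
  move: (lmono int (5%N%:Z * (2 * M)%N%:Z + 5%N%:Z)) => y4.
  move: (lmono int (2%N%:Z * (5 * M)%N.+2%:Z + 2%N%:Z)) => y5.
  move: (lmono int (10%N%:Z * M%:Z + 10%N%:Z - 3%N%:Z)) => y6.
  move: (lmono int (2%N%:Z * (5 * M)%N.+3%:Z + 2%N%:Z)) => y7.
  move: (lmono int (10%N%:Z * M%:Z + 10%N%:Z - 1%N%:Z)) => y8.
  move: (lmono int (10%N%:Z * M%:Z + 10%N%:Z)) => y9.
  transitivity (B * J * (B * K) * C * D *
    ((1 - y0) * (1 - y1) * (1 - y2) * (1 - y3) * (1 - y4) * (1 - y5) * (1 - y6) *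
     (1 - y7) * (1 - y8) * (1 - y9) ^+ 4)); first by ring.
  by rewrite IH; ring.
apply: (@vge_trans _ _ (eprod 1 (10 * M) * eprod 10 M ^+ 3)).
  rewrite -E; apply: vge_subM; last by apply: vge_le (@f_eprod 5 (2 * M) _); lia.
  - exact: vge_f.
  - by do !apply: vge0M; try exact: vge_eprod; exact: vge_jprod.
  apply: vge_subM; last by apply: vge_le (@f_eprod 2 (5 * M) _); lia.
  - exact: vge_f.
  - by do !apply: vge0M; try exact: vge_eprod; exact: vge_jprod.
  apply: vge_subM; last by apply: jtp.
  - exact: vge_theta.
  - by apply: vge0M; [exact: vge_eprod|exact: vge_jprod].
  - exact: jtp.
apply: vge_sym; apply: vge_subM.
- by apply: vge_exp; exact: vge_f.
- exact: vge_eprod.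
- by apply: vge_le (@f_eprod 1 (10 * M) _); lia.
- by apply: vge_subX; [exact: vge_f|exact: vge_eprod|exact: f_eprod].
Qed.

(** * Dissections modulo 5 *)

(** [L] is the form whose residue modulo 5 sorts the indices, and [h r] parametrises class [r]. It
    is the identity for single theta series and [2 i + j] for the square of [phi]. *)
Lemma gsum_split5 (I K : choiceType) (w e L : I -> int) (h : nat -> K -> I) :
  locfin w ->
  (forall r, injective (h r)) ->
  (forall (r : nat) k, (r < 5)%N -> (5 %| L (h r k) - r%:Z)%Z) ->
  (forall (r : nat) i, (r < 5)%N -> (5 %| L i - r%:Z)%Z -> exists k, i = h r k) ->
  gsum w e = \sum_(r < 5) gsum (fun k => w (h r k)) (fun k => e (h r k)).
Proof.
move=> wf hinj hL hsurj.
pose cls i : 'I_5 := inord `|(L i %% 5)%Z|.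
have clsE i (r : 'I_5) : (cls i == r) = (5 %| L i - r%:Z)%Z.
  have := ltn_ord r; rewrite -val_eqE /= inordK; lia.
rewrite (gsum_class _ cls wf); apply: eq_bigr => r _.
rewrite (gsum_reindex _ (hinj r)) => [|i]; last first.
  by rewrite clsE; case: ifP => // ir _; apply: hsurj.
by apply: gsum_ext => // k; rewrite clsE hL.
Qed.

Lemma sgn_eq i j : (2 %| i - j)%Z -> sgn i = sgn j.
Proof.
move=> ij; rewrite /sgn -signr_odd -[RHS]signr_odd.
by have -> : odd `|i| = odd `|j| by lia.
Qed.

Lemma sgnD i j : sgn (i + j) = sgn i * sgn j.
Proof.
rewrite /sgn -exprD -signr_odd -[RHS]signr_odd.
by have -> : odd `|i + j| = odd (`|i| + `|j|) by lia.
Qed.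

Lemma sgn_opp i j : (2 %| i - j - 1)%Z -> sgn i = - sgn j.
Proof. by move=> ij; rewrite (@sgn_eq i (j + 1)) ?sgnD ?mulrN1//; lia. Qed.

Lemma gsumN (I : choiceType) (w e : I -> int) : gsum w (fun i => - e i) = - gsum w e.
Proof.
rewrite -(gsum_ext (w := w) (e := fun i => -1 * e i)) => [|//|i]; last by rewrite mulN1r.
by rewrite gsum_scale mulN1r.
Qed.

Lemma res_gsum (I : choiceType) (w e : I -> int) r :
  (forall i, (5 %| w i - r)%Z) -> res r (gsum w e).
Proof.
move=> h n nr /=; rewrite /gcoef; case: ltP => // _.
rewrite (_ : [set i | _] = set0) ?fsbig_set0// -subset0 => i /= wi.
by move: nr; rewrite -wi h.
Qed.

Lemma tw2 j : tw 2 1 j = j * j.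
Proof. by have := tri2 j; rewrite /tw => E; rewrite mulrC E; ring. Qed.

Lemma tw10 e j : tw 10 e j = 5 * j * j - 5 * j + e%:Z * j.
Proof. 
rewrite /tw; have -> : 10%N%:Z * tri j = 5 * (tri j * 2) by ring.
by rewrite tri2; ring.
Qed.

Definition phi := theta 2 1.

Lemma phi_eta : phi = f 1 ^+ 2 / f 2.
Proof. by rewrite -gauss_square mulrK// f_unit. Qed.

Lemma phi_dissection :
  phi = Vsub 4 (Vsub 4 phi) - 2%:R * (q * Vsub 4 (theta 10 3)) +
        2%:R * (q ^+ 4 * Vsub 4 (theta 10 1)).
Proof.
(* [h 4 = - h 1] and [h 3 = - h 2], so opposite classes have the same squares; this produces the
   factors 2. *)
pose h (r : nat) (k : int) : int :=
  match r with 0 => 5 * k | 1 => 1 - 5 * k | 2 => 2 - 5 * k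
             | 3 => 5 * k - 2 | _ => 5 * k - 1 end.
have w0 c e : (0 < e < c)%N -> forall i, 0 <= tw c e i.
  by move=> ec; exact: (proj1 (tw_locfin ec)).
have V5w0 e : (0 < e < 10)%N -> forall i, 0 <= 5%:Z * tw 10 e i.
  by move=> ec i; rewrite mulr_ge0// w0.
rewrite {1}/phi /theta (@gsum_split5 _ _ _ _ id h); first last.
- move=> r i; case: r => [|[|[|[|[|//]]]]] _ /dvdzP[k E]; rewrite /h;
    [exists k|exists (- k)|exists (-k)|exists (k + 1)|exists (k + 1)]; lia.
- by move=> r k; case: r => [|[|[|[|[|//]]]]] _; rewrite /h; lia.
- by move=> r i j; case: r => [|[|[|[|?]]]]; rewrite /h; lia.
- exact: tw_locfin.
have E1 : gsum (fun k => tw 2 1 (h 1%N k)) (fun k => sgn (h 1%N k)) = - (q * Vsub 4 (theta 10 3)).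
  rewrite Vsub_gsum -(gsum_shift _ 1%N (V5w0 3%N isT)) -[RHS]gsumN; apply: gsum_ext => k.
    by rewrite tw2 tw10 /h; ring.
  by apply: sgn_opp; rewrite /h; lia.
have E4 : gsum (fun k => tw 2 1 (h 4%N k)) (fun k => sgn (h 4%N k)) = - (q * Vsub 4 (theta 10 3)).
  rewrite Vsub_gsum -(gsum_shift _ 1%N (V5w0 3%N isT)) -[RHS]gsumN; apply: gsum_ext => k.
    by rewrite tw2 tw10 /h; ring.
  by apply: sgn_opp; rewrite /h; lia.
have q4 : q ^+ 4 = lmono int 4%N by rewrite lmonoX.
have E2 : gsum (fun k => tw 2 1 (h 2%N k)) (fun k => sgn (h 2%N k)) = q ^+ 4 * Vsub 4 (theta 10 1).
  rewrite Vsub_gsum q4 -(gsum_shift _ 4%N (V5w0 1%N isT)); apply: gsum_ext => k.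
    by rewrite tw2 tw10 /h; ring.
  by apply: sgn_eq; rewrite /h; lia.
have E3 : gsum (fun k => tw 2 1 (h 3%N k)) (fun k => sgn (h 3%N k)) = q ^+ 4 * Vsub 4 (theta 10 1).
  rewrite Vsub_gsum q4 -(gsum_shift _ 4%N (V5w0 1%N isT)); apply: gsum_ext => k.
    by rewrite tw2 tw10 /h; ring.
  by apply: sgn_eq; rewrite /h; lia.
have E0 : gsum (fun k => tw 2 1 (h 0%N k)) (fun k => sgn (h 0%N k)) = Vsub 4 (Vsub 4 phi).
  rewrite /phi !Vsub_gsum; apply: gsum_ext => k.
    by rewrite !tw2 /h; ring.
  by apply: sgn_eq; rewrite /h; lia.
rewrite !big_ord_recl big_ord0 /bump /= E0 E1 E2 E3 E4; ring.
Qed.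

(* [h 0] runs over the ideal [(2 + i)] of [Z[i]], and the other [h r] are the
   four other classes, which multiplication by [i] permutes. *)
Lemma phi_square : phi ^+ 2 - Vsub 4 phi ^+ 2 = - 4%:R * (q * (theta 10 1 * theta 10 3)).
Proof.
(* For [k = (s, t)], [A + B i = 1 - (2 + i) s + i (2 + i) t], so [A^2 + B^2 = 1 + (5 s^2 - 4 s) + (5
   t^2 - 2 t)]: the exponents of [q * theta 10 1 * theta 10 3]. *)
pose h (r : nat) (k : int * int) : int * int :=
  let A := 1 - 2 * k.1 - k.2 in let B := 2 * k.2 - k.1 in
  match r with 0 => (2 * k.1 - k.2, k.1 + 2 * k.2) | 1 => (- B, A) | 2 => (A, B)
             | 3 => (- A, - B) | _ => (B, - A) end.
pose W (p : int * int) := tw 2 1 p.1 + tw 2 1 p.2.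
pose S (p : int * int) := sgn p.1 * sgn p.2.
have tw0 c e : (0 < e < c)%N -> forall i, 0 <= tw c e i.
  by move=> ec; exact: (proj1 (tw_locfin ec)).
have phi2 : phi * phi = gsum W S by apply: gsumM; apply: tw_locfin.
have Wf : locfin W.
  have [w0 wf] := @tw_locfin 2 1 isT; split=> [p|n]; first by rewrite addr_ge0.
  have [s us hs] := wf n; exists [seq (i, j) | i <- s, j <- s].
    by apply: allpairs_uniq => // -[? ?] [? ?].
  case=> i j; rewrite /W /= => ij; apply: allpairs_f; apply: hs.
    by have := w0 j; lia.
  by have := w0 i; lia.
have E0 : gsum (fun k => W (h 0%N k)) (fun k => S (h 0%N k)) = Vsub 4 (phi * phi).
  rewrite phi2 Vsub_gsum; apply: gsum_ext => -[s t].
    by rewrite /W !tw2 /h /=; ring.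
  by rewrite /S -!sgnD; apply: sgn_eq; rewrite /h /=; lia.
have E (r : nat) : (0 < r < 5)%N ->
    gsum (fun k => W (h r k)) (fun k => S (h r k)) = - (q * (theta 10 1 * theta 10 3)).
  move=> r5; rewrite gsumM; try exact: tw_locfin.
  rewrite -(gsum_shift _ 1%N); last by move=> [s t]; rewrite addr_ge0// tw0.
  rewrite -[RHS]gsumN; apply: gsum_ext => -[s t].
    by case: r r5 => [//|[|[|[|[|//]]]]] _; rewrite /W !tw2 !tw10 /h /=; ring.
  rewrite /S -!sgnD; apply: sgn_opp.
  by case: r r5 => [//|[|[|[|[|//]]]]] _; rewrite /h /=; lia.
rewrite !expr2 -rmorphM [X in X - _]phi2.
rewrite [X in X - _](@gsum_split5 _ _ W S (fun p => 2 * p.1 + p.2) h) //; first last.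
- move=> r [i j]; case: r => [|[|[|[|[|//]]]]] _ /dvdzP[k /= kE]; rewrite /h /=.
  + by exists (k, 2 * k - i) => /=; congr pair; lia.
  + by exists (i - 2 * k, - k) => /=; congr pair; lia.
  + by exists (- k, 1 + 2 * k - i) => /=; congr pair; lia.
  + by exists (k + 1, i - 1 - 2 * k) => /=; congr pair; lia.
  + by exists (2 * k + 2 - i, k + 1) => /=; congr pair; lia.
- by move=> r [s t]; case: r => [|[|[|[|[|//]]]]] _; rewrite /h /=; lia.
- move=> r [s t] [s' t']; case: r => [|[|[|[|?]]]]; rewrite /h /= => -[? ?];
    congr pair; lia.
rewrite !big_ord_recl big_ord0 /bump /= E0 (E 1%N) ?(E 2%N) ?(E 3%N) ?(E 4%N)//; ring.
Qed.

(** Pentagonal numbers are 0, 1 or 2 modulo 5. Residue 1 comes only from indices [1 - 5 k], whose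
    pentagonal number is 1 plus 25 times that of [k]; this gives [- q * f 25]. *)
Lemma f1_dissection : exists S0 S2,
  [/\ res 0 S0, res 2 S2 & f 1 = S0 - q * f 25 + S2].
Proof.
pose h (r : nat) (k : int) : int := if r == 1%N then 1 - 5 * k else 5 * k + r%:Z.
pose G r := gsum (fun k => tw 3 1 (h r k)) (fun k => sgn (h r k)).
have w0 := proj1 (@tw_locfin 3 1 isT).
have tw3 j : tw 3 1 j * 2 = 3 * j * j - j.
  by have := tri2 j; rewrite /tw; lia.
have E1 : G 1%N = - (q * f 25).
  have -> : f 25 = Vsub 24 (theta 3 1) by rewrite -euler_pentagonal Vsub_f.
  rewrite Vsub_gsum -(gsum_shift _ 1%N); last by move=> i; rewrite mulr_ge0.
  rewrite -[RHS]gsumN; apply: gsum_ext => k.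
    by have := tw3 k; have := tw3 (h 1%N k); rewrite /h /=; lia.
  by apply: sgn_opp; rewrite /h /=; lia.
exists (G 0%N + G 2%N), (G 3%N + G 4%N); split.
- apply: resD; apply: res_gsum => k; set t := tw _ _ _;
    have := tw3 (h 0%N k); have := tw3 (h 2%N k); rewrite /h /= -/t; lia.
- apply: resD; apply: res_gsum => k; set t := tw _ _ _;
    have := tw3 (h 3%N k); have := tw3 (h 4%N k); rewrite /h /= -/t; lia.
rewrite euler_pentagonal /theta (@gsum_split5 _ _ _ _ id h).
- rewrite !big_ord_recl big_ord0 /bump /= -/(G 0%N) -/(G 1%N) -/(G 2%N) -/(G 3%N) -/(G 4%N) E1.
  by ring.
- exact: tw_locfin.
- by move=> r i j; rewrite /h; case: ifP => _; lia.
- by move=> r k r5; rewrite /h; case: eqP => [->|_]; lia.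
- move=> r i r5 /dvdzP[k E]; rewrite /h; case: eqP => [re|_].
    by exists (- k); lia.
  by exists k; lia.
Qed.

(** * Eta quotients in terms of theta series *)

Lemma natr_inj (n : nat) (a b : laurent int) : (0 < n)%N -> n%:R * a = n%:R * b -> a = b.
Proof.
move=> n0 e; apply: laurentP => m.
have E c : lcoef (n%:R * c) m = n%:Z * lcoef c m by exact: (lcoef_intM n%:Z).
by have := congr1 (fun c => lcoef c m) e; rewrite !E => /mulfI; apply; lia.
Qed.

Lemma phi_unit : phi \is a GRing.unit.
Proof. by rewrite phi_eta unitrM unitrX ?f_unit// unitrV f_unit. Qed.

Lemma Vsub_unit k a : a \is a GRing.unit -> Vsub k a \is a GRing.unit.
Proof. exact: rmorph_unit. Qed.

(** This is [x / (1 + 4 x)] ([kappa_g0]), and [Vsub 4 g0] is the [g] of the quintic; the theta form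
    is the one that [phi_square] provides. *)
Definition g0 : laurent int := q * (theta 10 1 * theta 10 3) / Vsub 4 phi ^+ 2.

Lemma phi_sq_g0 : phi ^+ 2 = (1 - 4%:R * g0) * Vsub 4 phi ^+ 2.
Proof.
have := phi_square; rewrite mulrBl mul1r -mulrA /g0 divrK ?unitrX ?Vsub_unit ?phi_unit//.
by move=> /eqP; rewrite subr_eq => /eqP ->; ring.
Qed.

Lemma unitM (R : comUnitRingType) (a b : R) :
  a \is a GRing.unit -> b \is a GRing.unit -> a * b \is a GRing.unit.
Proof. by rewrite unitrM => -> ->. Qed.

Lemma unitX (R : comUnitRingType) (a : R) n : a \is a GRing.unit -> a ^+ n \is a GRing.unit.
Proof. exact: unitrX. Qed.

Lemma xE : x * (f 1 ^+ 3 * f 5) = q * (f 2 * f 10 ^+ 3).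
Proof.
have u : f 1 ^+ 3 * f 5 \is a GRing.unit by apply: unitM; [apply: unitX|]; apply: f_unit.
by rewrite /x -mulrA (divrK u).
Qed.

Lemma phiE : phi * f 2 = f 1 ^+ 2. Proof. exact: gauss_square. Qed.

Lemma PhiE : Phi * (f 1 * f 2 ^+ 2) = q ^+ 5 * (f 25 * f 50 ^+ 2).
Proof.
have u : f 1 * f 2 ^+ 2 \is a GRing.unit by apply: unitM; [|apply: unitX]; apply: f_unit.
by rewrite /Phi -mulrA; congr (_ * _); apply: divrK.
Qed.

Lemma x_phi : x * phi ^+ 2 = q * (theta 10 1 * theta 10 3).
Proof.
apply: (mulIr (_ : f 1 ^+ 3 * f 5 * f 2 ^+ 2 \is a GRing.unit)).
  by apply: unitM; [apply: unitM; [apply: unitX|]|apply: unitX]; apply: f_unit.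
transitivity ((x * (f 1 ^+ 3 * f 5)) * (phi * f 2) ^+ 2); first by ring.
rewrite xE phiE.
transitivity (q * f 1 ^+ 3 * f 2 * (theta 10 1 * theta 10 3 * f 2 * f 5)); last by ring.
by rewrite theta10_prod; ring.
Qed.

Lemma x_g0 : (1 + 4%:R * x) * (1 - 4%:R * g0) = 1.
Proof.
have u5 : Vsub 4 phi ^+ 2 \is a GRing.unit by rewrite unitrX ?Vsub_unit ?phi_unit.
apply: (mulIr u5); rewrite -mulrA -phi_sq_g0 mul1r mulrDl -mulrA x_phi mul1r.
have := phi_square => /eqP; rewrite subr_eq => /eqP ->; ring.
Qed.

(** * The relations satisfied by [sigma], and its quintic *)

Definition sigma : laurent int := phi / Vsub 4 (Vsub 4 phi).

Lemma s_unit : sigma \is a GRing.unit.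
Proof. by rewrite unitrM unitrV !Vsub_unit// phi_unit. Qed.

Lemma sE : sigma * Vsub 4 (Vsub 4 phi) = phi.
Proof. by rewrite divrK// !Vsub_unit// phi_unit. Qed.

Lemma s_sq : sigma ^+ 2 * (1 + 4%:R * x) = 1 - 4%:R * Vsub 4 g0.
Proof.
have u25 : Vsub 4 (Vsub 4 phi) ^+ 2 \is a GRing.unit.
  by rewrite unitrX ?Vsub_unit ?phi_unit.
apply: (mulIr u25); transitivity ((1 + 4%:R * x) * (sigma * Vsub 4 (Vsub 4 phi)) ^+ 2); first by ring.
rewrite sE phi_sq_g0 mulrA x_g0 mul1r.
have := congr1 (Vsub 4) phi_sq_g0; by rewrite rmorphXn [in RHS]rmorphM rmorphXn rmorphB rmorph1 rmorphM rmorph_nat.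
Qed.

(** Its value at [q^5] is, to the fifth power, the quotient of [sigma^7 x^5] by [Phi];
    [level50_structure] identifies that value with [1 + g]. *)
Definition C0 : laurent int := f 10 * f 2 ^+ 3 / (f 5 ^+ 3 * f 1).

Lemma C0E : Vsub 4 C0 * (f 25 ^+ 3 * f 5) = f 50 * f 10 ^+ 3.
Proof.
have u : f 5 ^+ 3 * f 1 \is a GRing.unit by apply: unitM; [apply: unitX|]; apply: f_unit.
have V3 m n : Vsub 4 (f m.+1 * f n.+1 ^+ 3) = f (5 * m.+1) * f (5 * n.+1) ^+ 3.
  by rewrite rmorphM rmorphXn /= !Vsub_f.
have -> : f 25 ^+ 3 * f 5 = Vsub 4 (f 5 ^+ 3 * f 1) by rewrite mulrC -(V3 0%N 4%N) mulrC.
by rewrite -(V3 9%N 1%N) -rmorphM /C0 (divrK u).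
Qed.

Lemma res_Vsub1 i j a : (5 %| 2 * i - j)%Z -> res i a -> res j (Vsub 1 a).
Proof.
move=> ij ha n nj; have [/dvdzP[m nE]|nd] := boolP (2 %| n)%Z; last exact: lcoef_Vsub0.
by rewrite nE mulrC lcoef_Vsub ha//; lia.
Qed.

Lemma res_V i a : res i a -> forall b, res i (Vsub 4 b * a).
Proof. by move=> ha b; apply: resM (res_Vsub b) ha; lia. Qed.

Lemma res_divV i a b : res i a -> b \is a GRing.unit -> res i (a / Vsub 4 b).
Proof. by move=> ha bu; rewrite mulrC -rmorphV//; apply: res_V. Qed.

Lemma divr_mul2 (R : comUnitRingType) (A B D G : R) :
  D \is a GRing.unit -> G * D ^+ 2 = A * B -> A / D * (B / D) = G.
Proof.
move=> u e; apply: (mulIr (unitrX 2 u)); rewrite e.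
by transitivity ((A / D * D) * (B / D * D)); [ring|rewrite !divrK].
Qed.

Lemma g0E : g0 * Vsub 4 phi ^+ 2 = q * (theta 10 1 * theta 10 3).
Proof. by apply: divrK; apply: unitX; apply: Vsub_unit; exact: phi_unit. Qed.

Lemma Vq : Vsub 4 q = q ^+ 5.
Proof. by rewrite /q Vsub_mono lmonoX. Qed.

(** Divide [phi_dissection] by [phi(q^25)]: the two remaining terms have product [g], because
    [q * q^4 = q^5] completes the theta product of [g0] at [q^5]. *)
Lemma s_dissection : exists a b, [/\ res 1 a, res 4 b, a * b = Vsub 4 g0 &
  sigma = 1 + 2%:R * (b - a)].
Proof.
have u25 : Vsub 4 (Vsub 4 phi) \is a GRing.unit by rewrite !Vsub_unit// phi_unit.
exists (q * Vsub 4 (theta 10 3) / Vsub 4 (Vsub 4 phi)),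
  (q ^+ 4 * Vsub 4 (theta 10 1) / Vsub 4 (Vsub 4 phi)); split.
- apply: res_divV; last by rewrite Vsub_unit ?phi_unit.
  by rewrite mulrC; apply: res_V; apply: res_mono.
- apply: res_divV; last by rewrite Vsub_unit ?phi_unit.
  by rewrite mulrC; apply: res_V; rewrite /q lmonoX; apply: res_mono.
- apply: (divr_mul2 u25).
  have -> : Vsub 4 g0 * Vsub 4 (Vsub 4 phi) ^+ 2 = Vsub 4 (q * (theta 10 1 * theta 10 3)).
    rewrite -g0E; move: (g0) (Vsub 4 phi) => g p.
    by rewrite [in RHS]rmorphM rmorphXn.
  rewrite VsubM (VsubM _ (theta 10 1)) Vq.
  by move: (q) (Vsub 4 (theta 10 3)) (Vsub 4 (theta 10 1)) => ? ? ?; ring.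
- apply: (mulIr u25); rewrite sE {1}phi_dissection.
  move: u25; move: (Vsub 4 (Vsub 4 phi)) (q * _) (q ^+ 4 * _) => p A B pu.
  transitivity (p + 2%:R * (B / p * p - A / p * p)); last by ring.
  by rewrite !(divrK pu); ring.
Qed.

Lemma split_factor (R : comUnitRingType) (p F A B : R) :
  p \is a GRing.unit -> F \is a GRing.unit ->
  A - p * F + B = p * F * (A / p / F - 1 - - (B / p / F)).
Proof.
move=> pu Fu.
transitivity (A / p / F * F * p - p * F + B / p / F * F * p); last by ring.
by rewrite !(divrK Fu) !(divrK pu).
Qed.

(** The classical 5-dissection of [f 1], normalised so that the middle term is [-1]. That [U] and
    [u] are reciprocal comes later, from [dissection_relations]. *)
Lemma f1_quotient : exists U u, [/\ res 4 U, res 1 u & f 1 = q * f 25 * (U - 1 - u)].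
Proof.
have [S0 [S2 [r0 r2 e]]] := f1_dissection.
have qu : q \is a GRing.unit by exact: lmono_unit.
have f5u : f 5 \is a GRing.unit by exact: f_unit.
have fu : f 25 \is a GRing.unit by exact: f_unit.
have qV : q^-1 = lmono int (-1).
  by apply: (mulIr qu); rewrite mulVr// -lmonoD.
have f25 : f 25 = Vsub 4 (f 5) by rewrite Vsub_f.
exists (S0 / q / f 25), (- (S2 / q / f 25)); split.
- rewrite f25; apply: res_divV f5u; rewrite qV.
  by apply: (resM _ r0 (@res_mono (-1) _ _)).
- rewrite f25; apply: resN; apply: res_divV f5u; rewrite qV.
  by apply: (resM _ r2 (@res_mono (-1) _ _)).
by rewrite {1}e; exact: split_factor.
Qed.

Lemma Vsub1_f : Vsub 1 (f 1) = f 2 /\ Vsub 1 (f 25) = f 50 /\ Vsub 1 q = q ^+ 2.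
Proof. by rewrite !Vsub_f// /q Vsub_mono lmonoX. Qed.

Lemma phi25 : Vsub 4 (Vsub 4 phi) * f 50 = f 25 ^+ 2.
Proof.
have := congr1 (Vsub 4) (congr1 (Vsub 4) phiE).
by rewrite 2!rmorphXn /= (VsubM 4 phi) (VsubM 4 (Vsub 4 phi)) !Vsub_f.
Qed.

Lemma two_eq0 (a : laurent int) : 2%:R * a = 0 -> a = 0.
Proof. by move=> e; apply: (@natr_inj 2) => //; rewrite e mulr0. Qed.

(** The hypothesis is [f_1^2 = phi f_2] divided by [q^2 f_25^2], with [V] and [v] standing for [U]
    and [u] at [q^2]. The five conclusions are its components of residues 0, 1, 2, 3, 4. *)
Lemma dissection_relations (a b U u V v : laurent int) :
  res 1 a -> res 4 b -> res 4 U -> res 1 u -> res 3 V -> res 2 v ->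
  (U - 1 - u) ^+ 2 = (1 + 2%:R * (b - a)) * (V - 1 - v) ->
  [/\ U * u = 1, u = a - b * v, u ^+ 2 = 2%:R * (b * V) - v, U ^+ 2 = V + 2%:R * (a * v)
    & U = a * V + b].
Proof.
move=> ra rb rU ru rV rv e.
have r0 : res 0 (2%:R * (1 - U * u)).
  rewrite -(rmorph_nat (Vsub 4) 2); apply: res_V; apply: resD; first exact: (res_nat 1).
  by apply: resN; apply: (resM _ rU ru).
have r1 : res 1 (2%:R * (u - (a - b * v))).
  rewrite -(rmorph_nat (Vsub 4) 2); apply: res_V; apply: resD => //.
  by apply: resN; apply: resD => //; apply: resN; apply: (resM _ rb rv).
have r2 : res 2 (u ^+ 2 - (2%:R * (b * V) - v)).
  rewrite -(rmorph_nat (Vsub 4) 2); apply: resD; first by apply: (resM _ ru ru).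
  apply: resN; apply: resD; last exact: resN.
  by apply: res_V; apply: (resM _ rb rV).
have r3 : res 3 (U ^+ 2 - (V + 2%:R * (a * v))).
  rewrite -(rmorph_nat (Vsub 4) 2); apply: resD; first by apply: (resM _ rU rU).
  apply: resN; apply: resD => //.
  by apply: res_V; apply: (resM _ ra rv).
have r4 : res 4 (2%:R * (a * V + b - U)).
  rewrite -(rmorph_nat (Vsub 4) 2); apply: res_V; apply: resD; last exact: resN.
  by apply: resD => //; apply: (resM _ ra rV).
have [|e0 e1 e2 e3 e4] := res_eq0 r0 r1 r2 r3 r4.
  by move/eqP: e; rewrite -subr_eq0 => /eqP <-; ring.
split; apply/eqP; rewrite -subr_eq0; apply/eqP.
- by apply: two_eq0; rewrite -[RHS]oppr0 -e0; ring.
- exact: two_eq0.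
- exact: e2.
- exact: e3.
- by apply: two_eq0; rewrite -[RHS]oppr0 -e4; ring.
Qed.

(** With [r = b^2 v] one finds [a^2 V = 1 + r] and [r (1 + r) = g^2]. Then [2 a^5] and [2 b^5] are
    polynomials in [r] and [g], and [r] enters their difference only through [r (1 + r)]. *)
Lemma quintic_constant (a b U u V v g : laurent int) :
  U * u = 1 -> V * v = 1 -> a * b = g ->
  u = a - b * v -> U = a * V + b ->
  u ^+ 2 = 2%:R * (b * V) - v -> U ^+ 2 = V + 2%:R * (a * v) ->
  b ^+ 5 - a ^+ 5 = - (g + g ^+ 2 + 2%:R * g ^+ 3) /\
  a * U + b * u = 1 + 2%:R * g.
Proof.
move=> Uu Vv ab u1 U1 u2 U2.
set r := b ^+ 2 * v.
have p1 : a ^+ 2 * V = 1 + r.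
  have : (a * V + b) * (a - b * v) = 1 by rewrite -U1 -u1.
  have -> : (a * V + b) * (a - b * v) = a ^+ 2 * V + a * b * (1 - V * v) - r by rewrite /r; ring.
  by rewrite Vv subrr mulr0 addr0 => /eqP; rewrite subr_eq => /eqP.
have pr : (1 + r) * r = g ^+ 2.
  rewrite -p1 /r -ab; transitivity ((a * b) ^+ 2 * (V * v)); first by ring.
  by rewrite Vv mulr1.
have a5 : 2%:R * a ^+ 5 = (1 + r) * ((1 + r + g) ^+ 2 - (1 + r)).
  have -> : 1 + r + g = a * U by rewrite -p1 -ab U1; ring.
  have -> : (a * U) ^+ 2 = a ^+ 2 * U ^+ 2 by ring.
  rewrite U2 -p1; transitivity (2%:R * a ^+ 5 * (V * v)); first by rewrite Vv mulr1.
  by ring.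
have b5 : 2%:R * b ^+ 5 = r * ((g - r) ^+ 2 + r).
  have -> : g - r = b * u by rewrite -ab u1 /r; ring.
  have -> : (b * u) ^+ 2 = b ^+ 2 * u ^+ 2 by ring.
  rewrite u2 /r; transitivity (2%:R * b ^+ 5 * (V * v)); first by rewrite Vv mulr1.
  by ring.
split.
  apply: (@natr_inj 2) => //; rewrite mulrBr a5 b5.
  transitivity (- g ^+ 2 - 2%:R * g - 4%:R * g * ((1 + r) * r) - (1 + r) * r); first by ring.
  by rewrite pr; ring.
transitivity (a ^+ 2 * V - r + 2%:R * (a * b)); first by rewrite U1 u1 /r; ring.
by rewrite p1 ab addrK.
Qed.

(** The component of residue 0: [4 C] on the left, and on the right what survives of the product
    after [a b = g], namely [4 (a U + b u - g)]. *)
Lemma C0_eq (a b U u g C : laurent int) :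
  res 1 a -> res 4 b -> res 4 U -> res 1 u -> res 0 g -> res 0 C -> a * b = g ->
  4%:R * C * (1 + 2%:R * (b - a)) =
    (1 - 4%:R * g - (1 + 2%:R * (b - a)) ^+ 2) * (U - 1 - u) ->
  C = a * U + b * u - g.
Proof.
move=> ra rb rU ru rg rC ab e.
have rn (n i : nat) c : res i c -> res i (n%:R * c).
  by move=> rc; rewrite -(rmorph_nat (Vsub 4) n); apply: res_V.
have ra2 : res 2 (a ^+ 2) by apply: (resM _ ra ra).
have rb2 : res 3 (b ^+ 2) by apply: (resM _ rb rb).
have r0 : res 0 (4%:R * (C - (a * U + b * u - g))).
  apply: (rn _ 0%N); apply: resD => //; apply: resN; apply: resD; last exact: resN.
  by apply: resD; [apply: (resM _ ra rU)|apply: (resM _ rb ru)].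
have r1 : res 1 (4%:R * (- (2%:R * (C * a)) + a + g * u + a ^+ 2 * U)).
  apply: (rn _ 1%N); apply: resD; last by apply: (resM _ ra2 rU).
  apply: resD; last by apply: (resM _ rg ru).
  by apply: resD => //; apply: resN; apply: (rn _ 1%N); apply: (resM _ rC ra).
have r2 : res 2 (4%:R * (a * u + b ^+ 2 * U - a ^+ 2)).
  apply: (rn _ 2%N); apply: resD; last exact: resN.
  by apply: resD; [apply: (resM _ ra ru)|apply: (resM _ rb2 rU)].
have r3 : res 3 (4%:R * (b * U - b ^+ 2 - a ^+ 2 * u)).
  apply: (rn _ 3%N); apply: resD; last by apply: resN; apply: (resM _ ra2 ru).
  by apply: resD; [apply: (resM _ rb rU)|exact: resN].
have r4 : res 4 (4%:R * (2%:R * (C * b) - g * U - b - b ^+ 2 * u)).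
  apply: (rn _ 4%N); apply: resD; last by apply: resN; apply: (resM _ rb2 ru).
  apply: resD; last exact: resN.
  apply: resD; last by apply: resN; apply: (resM _ rg rU).
  by apply: (rn _ 4%N); apply: (resM _ rC rb).
have [|e0 _ _ _ _] := res_eq0 r0 r1 r2 r3 r4.
  by move/eqP: e; rewrite -subr_eq0 => /eqP <-; rewrite -ab; ring.
by apply/eqP; rewrite -subr_eq0; apply/eqP; apply: (@natr_inj 4) => //; rewrite e0 mulr0.
Qed.

Lemma phi_V_sq :
  phi ^+ 2 = Vsub 4 phi ^+ 2 - 4%:R * (q * (theta 10 1 * theta 10 3)).
Proof. by have /eqP := phi_square; rewrite subr_eq => /eqP ->; ring. Qed.

(** Stated over an abstract ring so that [ring] only meets variables; both sides are multiplied by a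
    unit that clears all eta denominators. *)
Lemma eta_clearing (R : comUnitRingType) (C sigma g p ph t1 t3 F1 F2 F5 F10 F25 F50 z E : R) :
  p \is a GRing.unit -> F2 \is a GRing.unit -> F5 \is a GRing.unit ->
  F25 \is a GRing.unit ->
  F1 = z * F25 * E -> C * (F25 ^+ 3 * F5) = F50 * F10 ^+ 3 ->
  t1 * t3 * F2 * F5 = F1 * F10 ^+ 3 -> ph * F2 = F1 ^+ 2 -> p * F50 = F25 ^+ 2 ->
  sigma * p = ph -> ph ^+ 2 = (1 - 4%:R * g) * p ^+ 2 - 4%:R * (z * (t1 * t3)) ->
  4%:R * C * sigma = (1 - 4%:R * g - sigma ^+ 2) * E.
Proof.
move=> pu F2u F5u F25u f1E Ce t10 pe p25 se pv.
apply: (mulIr (_ : p ^+ 2 * F2 * F5 * F25 ^+ 3 \is a GRing.unit)).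
  by rewrite (unitM (unitM (unitM (unitX 2 pu) F2u) F5u) (unitX 3 F25u)).
transitivity (4%:R * (C * (F25 ^+ 3 * F5)) * p * (sigma * p * F2)); first by ring.
rewrite Ce se pe.
transitivity (4%:R * F10 ^+ 3 * F1 ^+ 2 * (p * F50)); first by ring.
rewrite p25; symmetry.
transitivity (((1 - 4%:R * g) * p ^+ 2 - (sigma * p) ^+ 2) * E * F2 * F5 * F25 ^+ 3); first by ring.
rewrite se pv.
transitivity (4%:R * (t1 * t3 * F2 * F5) * F25 ^+ 2 * (z * F25 * E)); first by ring.
by rewrite t10 -f1E; ring.
Qed.

Lemma eta_quotient_sq (R : comUnitRingType) (sigma p ph F1 F2 F25 F50 z E W : R) :
  z \is a GRing.unit -> F25 \is a GRing.unit ->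
  F1 = z * F25 * E -> F2 = z ^+ 2 * F50 * W ->
  ph * F2 = F1 ^+ 2 -> p * F50 = F25 ^+ 2 -> sigma * p = ph -> E ^+ 2 = sigma * W.
Proof.
move=> zu F25u f1E f2E pe p25 se; apply: (mulrI (unitM (unitX 2 zu) (unitX 2 F25u))).
transitivity (F1 ^+ 2); first by rewrite f1E; ring.
by rewrite -pe f2E -p25 -se; ring.
Qed.

Lemma C0_s_rel (E : laurent int) : f 1 = q * f 25 * E ->
  4%:R * Vsub 4 C0 * sigma = (1 - 4%:R * Vsub 4 g0 - sigma ^+ 2) * E.
Proof.
move=> f1E.
have V5phi : Vsub 4 phi ^+ 2 = (1 - 4%:R * Vsub 4 g0) * Vsub 4 (Vsub 4 phi) ^+ 2.
  have := congr1 (Vsub 4) phi_sq_g0.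
  by rewrite rmorphXn [in RHS]rmorphM rmorphXn rmorphB rmorph1 rmorphM rmorph_nat.
have pv := phi_V_sq; rewrite V5phi in pv.
have pu : Vsub 4 (Vsub 4 phi) \is a GRing.unit.
  by apply: Vsub_unit; apply: Vsub_unit; exact: phi_unit.
have u2 : f 2 \is a GRing.unit by exact: f_unit.
have u5 : f 5 \is a GRing.unit by exact: f_unit.
have u25 : f 25 \is a GRing.unit by exact: f_unit.
exact: (eta_clearing pu u2 u5 u25 f1E C0E theta10_prod phiE phi25 sE pv).
Qed.

Lemma level50_structure : exists a b,
  [/\ res 1 a, res 4 b, a * b = Vsub 4 g0, sigma = 1 + 2%:R * (b - a) &
      b ^+ 5 - a ^+ 5 = - (Vsub 4 g0 + Vsub 4 g0 ^+ 2 + 2%:R * Vsub 4 g0 ^+ 3)] /\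
  Vsub 4 C0 = 1 + Vsub 4 g0.
Proof.
have [a [b [ra rb ab sab]]] := s_dissection.
have [U [u [rU ru f1E]]] := f1_quotient.
have [V1 [V25 Vq1]] := Vsub1_f.
have f2E : f 2 = q ^+ 2 * f 50 * (Vsub 1 U - 1 - Vsub 1 u).
  by rewrite -V1 f1E !VsubM V25 Vq1 !rmorphB rmorph1.
have rV : res 3 (Vsub 1 U) by apply: res_Vsub1 rU.
have rv : res 2 (Vsub 1 u) by apply: res_Vsub1 ru.
have qu : q \is a GRing.unit by exact: lmono_unit.
have f25u : f 25 \is a GRing.unit by exact: f_unit.
have f50u : f 50 \is a GRing.unit by exact: f_unit.
have E12 : (U - 1 - u) ^+ 2 = sigma * (Vsub 1 U - 1 - Vsub 1 u).
  exact: (eta_quotient_sq qu f25u f1E f2E phiE phi25 sE).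
have [|Uu u1 u2 U2 U1] := dissection_relations ra rb rU ru rV rv; first by rewrite E12 sab.
have Vv : Vsub 1 U * Vsub 1 u = 1 by rewrite -VsubM Uu Vsub1.
have [b5 aU] := quintic_constant Uu Vv ab u1 U1 u2 U2.
exists a, b; split => //.
have rg : res 0 (Vsub 4 g0) by apply: res_Vsub.
have rC : res 0 (Vsub 4 C0) by apply: res_Vsub.
rewrite (C0_eq ra rb rU ru rg rC ab) ?aU; first by ring.
rewrite -sab; exact: C0_s_rel.
Qed.

(** * Computation with dense polynomials *)

(** Coefficient lists, lowest degree first, over any coefficient type: [Z] gives one variable
    ([zev]), lists of [Z] give two ([bev]). Identities are decided by [vm_compute] and carried to
    series by evaluation. *)
Fixpoint ladd (A : Type) (add : A -> A -> A) (l m : seq A) : seq A :=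
  match l, m with
  | [::], _ => m
  | _, [::] => l
  | a :: l', b :: m' => add a b :: ladd add l' m'
  end.

Fixpoint lprod (A : Type) (zero : A) (add mul : A -> A -> A) (l m : seq A) : seq A :=
  if l is a :: l' then ladd add (map (mul a) m) (zero :: lprod zero add mul l' m) else [::].

Definition lev (A : Type) (R : pzRingType) (e : A -> R) (t : R) (l : seq A) : R :=
  foldr (fun a acc => e a + t * acc) 0 l.

Lemma lev_add (A : Type) (R : pzRingType) (e : A -> R) t add l m :
  (forall a b, e (add a b) = e a + e b) ->
  lev e t (ladd add l m) = lev e t l + lev e t m.
Proof.
move=> eD; elim: l m => [|a l IH] [|b m] /=; rewrite ?add0r ?addr0//.
by rewrite eD -/(lev e t _) IH mulrDr addrACA.
Qed.

Lemma lev_prod (A : Type) (R : comPzRingType) (e : A -> R) t zero add mul l m :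
  e zero = 0 -> (forall a b, e (add a b) = e a + e b) ->
  (forall a b, e (mul a b) = e a * e b) ->
  lev e t (lprod zero add mul l m) = lev e t l * lev e t m.
Proof.
move=> e0 eD eM; elim: l => [|a l IH]; first by rewrite /= mul0r.
rewrite [lprod _ _ _ _ _]/= lev_add//= -!/(lev e t _) e0 add0r IH mulrDl mulrA; congr (_ + _).
elim: m {IH} => [|b m IH]; first by rewrite /= mulr0.
by rewrite /= -!/(lev e t _) IH eM mulrDr !mulrA [t * _]mulrC.
Qed.

Definition Zr (R : pzRingType) (z : Z) : R := (int_of_Z z)%:~R.

Definition zadd := ladd Z.add.
Definition zmul := lprod 0%BZ Z.add Z.mul.
Definition zev (R : pzRingType) (t : R) (l : seq Z) : R := lev (@Zr R) t l.

Arguments zev : simpl never.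

Lemma zev_nil (R : pzRingType) (t : R) : zev t [::] = 0. Proof. by []. Qed.

Lemma ZrD (R : pzRingType) a b : Zr R (a + b)%BZ = Zr R a + Zr R b.
Proof. by rewrite /Zr -intrD -rmorphD. Qed.

Lemma ZrM (R : pzRingType) a b : Zr R (a * b)%BZ = Zr R a * Zr R b.
Proof. by rewrite /Zr -intrM -rmorphM. Qed.

Lemma zevD (R : pzRingType) (t : R) l m : zev t (zadd l m) = zev t l + zev t m.
Proof. exact: lev_add (@ZrD R). Qed.

Lemma zevM (R : comPzRingType) (t : R) l m : zev t (zmul l m) = zev t l * zev t m.
Proof. exact: lev_prod (@ZrD R) (@ZrM R). Qed.

Lemma zev_cons (R : pzRingType) (t : R) c l : zev t (c :: l) = Zr R c + t * zev t l.
Proof. by []. Qed.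

Definition badd := ladd zadd.
Definition bmul := lprod [::] zadd zmul.
Definition bev (R : pzRingType) (t u : R) (l : seq (seq Z)) : R := lev (zev t) u l.

Arguments bev : simpl never.

Lemma bev_nil (R : pzRingType) (t u : R) : bev t u [::] = 0. Proof. by []. Qed.

Lemma bevD (R : pzRingType) (t u : R) l m : bev t u (badd l m) = bev t u l + bev t u m.
Proof. exact: lev_add (@zevD R t). Qed.

Lemma bevM (R : comPzRingType) (t u : R) l m : bev t u (bmul l m) = bev t u l * bev t u m.
Proof. exact: lev_prod (@zevD R t) (@zevM R t). Qed.

Lemma bev_cons (R : pzRingType) (t u : R) c l : bev t u (c :: l) = zev t c + u * bev t u l.
Proof. by []. Qed.

Definition zscale c := map (Z.mul c).
Definition bscale c := map (zscale c).

Lemma zevZ (R : comPzRingType) (t : R) c l : zev t (zscale c l) = Zr R c * zev t l.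
Proof.
elim: l => [|a l IH]; first by rewrite zev_nil mulr0.
by rewrite /zscale /= !zev_cons ZrM -/(zscale c l) IH mulrDr mulrCA.
Qed.

Lemma bevZ (R : comPzRingType) (t u : R) c l : bev t u (bscale c l) = Zr R c * bev t u l.
Proof.
elim: l => [|a l IH]; first by rewrite bev_nil mulr0.
by rewrite /bscale /= !bev_cons zevZ -/(bscale c l) IH mulrDr mulrCA.
Qed.

Definition zzero := all (Z.eqb 0%BZ).
Definition bzero := all zzero.

Lemma zzeroP (R : pzRingType) (t : R) l : zzero l -> zev t l = 0.
Proof.
elim: l => // -[|p|p] l IH //= /IH e.
by rewrite zev_cons e mulr0 addr0.
Qed.

Lemma bzeroP (R : pzRingType) (t u : R) l : bzero l -> bev t u l = 0.
Proof.
by elim: l => // a l IH /= /andP[az /IH e]; rewrite bev_cons e (zzeroP _ az) mulr0 addr0.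
Qed.

(** Testing the difference for zero ignores trailing zeros, which the list operations create. *)
Definition zeqb l m := zzero (zadd l (zscale (-1)%BZ m)).
Definition beqb l m := bzero (badd l (bscale (-1)%BZ m)).

Lemma ZrN1 (R : pzRingType) : Zr R (-1)%BZ = -1. Proof. by []. Qed.

Lemma zeqbP (R : comPzRingType) (t : R) l m : zeqb l m -> zev t l = zev t m.
Proof. by move=> /(zzeroP t) /eqP; rewrite zevD zevZ ZrN1 mulN1r subr_eq0 => /eqP. Qed.

Lemma beqbP (R : comPzRingType) (t u : R) l m : beqb l m -> bev t u l = bev t u m.
Proof. by move=> /(bzeroP t u) /eqP; rewrite bevD bevZ ZrN1 mulN1r subr_eq0 => /eqP. Qed.

Lemma zev_rmorph (R S : pzRingType) (g : {rmorphism R -> S}) (t : R) l :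
  g (zev t l) = zev (g t) l.
Proof.
elim: l => [|c l IH]; first by rewrite !zev_nil rmorph0.
by rewrite !zev_cons rmorphD rmorphM IH /Zr rmorph_int.
Qed.

Definition zone : seq Z := [:: 1%BZ].
Definition zX : seq Z := [:: 0; 1]%BZ.
Definition zexp l n := iter n (zmul l) zone.

Lemma zev_one (R : comPzRingType) (t : R) : zev t zone = 1.
Proof. by rewrite /zone zev_cons zev_nil mulr0 addr0. Qed.

Lemma zevX (R : comPzRingType) (t : R) l n : zev t (zexp l n) = zev t l ^+ n.
Proof.
elim: n => [|n IH]; first exact: zev_one.
by rewrite /zexp iterS zevM -/(zexp l n) IH exprS.
Qed.

Definition bexp l n := iter n (bmul l) [:: zone].

Lemma bevX (R : comPzRingType) (t u : R) l n : bev t u (bexp l n) = bev t u l ^+ n.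
Proof.
elim: n => [|n IH]; first by rewrite /bexp /= bev_cons zev_one bev_nil mulr0 addr0.
by rewrite /bexp iterS bevM -/(bexp l n) IH exprS.
Qed.

(* Row [j] lists the coefficients of the polynomial in [x(q^5)] multiplying [x^j]. *)
Definition modular_coefs : seq (seq Z) :=
  ([:: [:: 0; 1; 20; 150; 500; 625];
    [:: 0; 15; 305; 2325; 7875; 10000];
    [:: 0; 85; 1750; 13525; 46500; 60000];
    [:: 0; 215; 4475; 35000; 122000; 160000];
    [:: 0; 205; 4300; 34000; 120000; 160000]])%BZ.

Definition cofactor_coefs : seq (seq Z) :=
  ([:: [:: 1; -3100; -62250; -467500; -1559375; -1950000];
    [:: -5; -31375; -641875; -4928125; -16812500; -21500000];
    [:: 25; -108750; -2259375; -17625000; -61250000; -80000000];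
    [:: -125; -128125; -2687500; -21250000; -75000000; -100000000];
    [:: 625]])%BZ.

(* The recursion for [U0] starts at [x^-5] rather than at [1]: there the values
   are much smaller and already obey the bound [pi0]. *)
Definition U0_coefs : seq (seq Z) :=
  ([:: [:: 1; -820; -9696; -46400; -115200; -128000];
    [:: 0; 181; 2224; 11200; 28800; 32000];
    [:: 0; -40; -515; -2720; -7200; -8000];
    [:: 0; 9; 121; 665; 1800; 2000];
    [:: 0; -2; -28; -160; -445; -500]])%BZ.

Definition U1_coefs : seq (seq Z) :=
  ([:: [:: 1];
    [:: 0; 41; 860; 6800; 24000; 32000];
    [:: 0; 86; 10195; 366600; 6534800; 68384000; 450720000; 1907200000; 
5056000000; 7680000000; 5120000000];
    [:: 0; 51; 27495; 2836265; 128688900; 3343692000; 56283680000; 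
656205600000; 5502096000000; 33821312000000; 153192960000000; 
506956800000000; 1195008000000000; 1904640000000000; 1843200000000000; 
819200000000000];
    [:: 0; 12; 32674; 8579260; 831492275; 42958434000; 1396773180000; 
31314949600000; 511802288800000; 6319880448000000; 60349364480000000; 
452174745600000000; 2679038592000000000; 12574269440000000000; 
46561935360000000000; 134544588800000000000; 297365504000000000000; 
485949440000000000000; 553779200000000000000; 393216000000000000000; 
131072000000000000000]])%BZ.

(** * The modular equation *)

(** The quintic reads [sigma * E = O] with [E] and [O] polynomials in [sigma^2]. Squaring leaves
    only even powers, and [sigma^2 = 1 / (k X)]; the two brackets are [E] and [O] cleared of
    denominators. *)
Lemma modular_algebra (R : comPzRingType) (sigma k X g : R) :
  (sigma - 1) ^+ 5 + 20%:R * g * (sigma - 1) ^+ 3 + 80%:R * g ^+ 2 * (sigma - 1)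
    + 32%:R * (g + g ^+ 2 + 2%:R * g ^+ 3) = 0 ->
  k * (1 - 4%:R * g) = 1 -> k * X * sigma ^+ 2 = 1 ->
  k * (1 + (15%:R * k - 5%:R) * X + (25%:R * k ^+ 2 - 25%:R * k + 5%:R) * X ^+ 2) ^+ 2 =
  X * (5%:R * k + (25%:R * k ^+ 2 - 15%:R * k) * X + X ^+ 2) ^+ 2.
Proof.
move=> eq5 kg kXs.
set A := 1 + _ * X + _; set B := 5%:R * k + _ + _.
have EA : A = k ^+ 2 * X ^+ 2 *
    (sigma ^+ 4 + (10%:R + 20%:R * g) * sigma ^+ 2 + (5%:R + 60%:R * g + 80%:R * g ^+ 2)).
  (* Factors [k X sigma^2] and [k (1 - 4 g)], both equal to 1, are inserted to eliminate [sigma] and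
     [g]. *)
  symmetry; transitivity ((k * X * sigma ^+ 2) ^+ 2
    + (15%:R * k - 5%:R * (k * (1 - 4%:R * g))) * X * (k * X * sigma ^+ 2)
    + (25%:R * k ^+ 2 - 25%:R * k * (k * (1 - 4%:R * g))
       + 5%:R * (k * (1 - 4%:R * g)) ^+ 2) * X ^+ 2); first by ring.
  by rewrite kXs kg /A; ring.
have EB : B = k * (k ^+ 2 * X ^+ 2 *
    (5%:R * sigma ^+ 4 + (10%:R + 60%:R * g) * sigma ^+ 2 + (1 - 4%:R * g) ^+ 3)).
  symmetry; transitivity (5%:R * k * (k * X * sigma ^+ 2) ^+ 2
    + (25%:R * k ^+ 2 - 15%:R * k * (k * (1 - 4%:R * g))) * X * (k * X * sigma ^+ 2)
    + (k * (1 - 4%:R * g)) ^+ 3 * X ^+ 2); first by ring.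
  by rewrite kXs kg /B; ring.
transitivity (k * A ^+ 2 * (k * X * sigma ^+ 2)); first by rewrite kXs mulr1.
have Os : sigma * (sigma ^+ 4 + (10%:R + 20%:R * g) * sigma ^+ 2 + (5%:R + 60%:R * g + 80%:R * g ^+ 2)) =
    5%:R * sigma ^+ 4 + (10%:R + 60%:R * g) * sigma ^+ 2 + (1 - 4%:R * g) ^+ 3.
  by apply/eqP; rewrite -subr_eq0; apply/eqP; rewrite -[RHS]eq5; ring.
by rewrite EA EB -Os; ring.
Qed.

Definition bX : seq (seq Z) := [:: [:: 1]; [:: 4]]%BZ.
Definition bk : seq (seq Z) := [:: [:: 1; 4]]%BZ.
Definition bc (c : Z) : seq (seq Z) := [:: [:: c]].
Definition modular_A := badd (bc 1) (badd
  (bmul (badd (bscale 15 bk) (bc (-5))) bX)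
  (bmul (badd (bscale 25 (bexp bk 2)) (badd (bscale (-25) bk) (bc 5))) (bexp bX 2))).
Definition modular_B := badd (bscale 5 bk) (badd
  (bmul (badd (bscale 25 (bexp bk 2)) (bscale (-15) bk)) bX) (bexp bX 2)).

Lemma Zr_nat (R : pzRingType) (n : nat) : Zr R (Z.of_nat n) = n%:R.
Proof. by rewrite /Zr (_ : int_of_Z _ = n%:Z) ?natz//; lia. Qed.

Lemma bev_bX (t u : laurent int) : bev t u bX = 1 + 4%:R * u.
Proof.
rewrite /bX !bev_cons bev_nil !zev_cons zev_nil (Zr_nat _ 1) (Zr_nat _ 4); ring.
Qed.

Lemma bev_bk (t u : laurent int) : bev t u bk = 1 + 4%:R * t.
Proof.
rewrite /bk !bev_cons bev_nil !zev_cons zev_nil (Zr_nat _ 1) (Zr_nat _ 4); ring.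
Qed.

Lemma bev_bc (t u : laurent int) c : bev t u (bc c) = Zr _ c.
Proof. by rewrite /bc bev_cons bev_nil zev_cons zev_nil; ring. Qed.

Lemma Zr_opp (R : pzRingType) (n : nat) : Zr R (- Z.of_nat n)%BZ = - n%:R.
Proof. by rewrite -(Zr_nat _ n) /Zr -intrN -rmorphN. Qed.

Lemma kappa_unit : 1 + 4%:R * x \is a GRing.unit.
Proof. by apply/unitrPr; exists (1 - 4%:R * g0); exact: x_g0. Qed.

Definition x5 := Vsub 4 x.

Lemma Vsub_1D (n : nat) a : Vsub 4 (1 + n%:R * a) = 1 + n%:R * Vsub 4 a.
Proof. by rewrite rmorphD rmorph1 rmorphM rmorph_nat. Qed.

Lemma Vsub_1B (n : nat) a : Vsub 4 (1 - n%:R * a) = 1 - n%:R * Vsub 4 a.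
Proof. by rewrite rmorphB rmorph1 rmorphM rmorph_nat. Qed.

Lemma kappa_V : Vsub 4 (1 + 4%:R * x) = 1 + 4%:R * x5.
Proof. exact: Vsub_1D. Qed.

Lemma kappa_g : (1 + 4%:R * x5) * (1 - 4%:R * Vsub 4 g0) = 1.
Proof.
by rewrite -kappa_V -(Vsub_1B 4) -VsubM x_g0 Vsub1.
Qed.

Lemma kappa_s : (1 + 4%:R * x5) * (1 + 4%:R * x) * sigma ^+ 2 = 1.
Proof. by rewrite -mulrA [_ * sigma ^+ 2]mulrC s_sq kappa_g. Qed.

Lemma s_quintic : let g := Vsub 4 g0 in
  (sigma - 1) ^+ 5 + 20%:R * g * (sigma - 1) ^+ 3 + 80%:R * g ^+ 2 * (sigma - 1)
    + 32%:R * (g + g ^+ 2 + 2%:R * g ^+ 3) = 0.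
Proof.
have [a [b [[_ _ ab sab h] _]]] := level50_structure.
rewrite /=; have -> : Vsub 4 g0 + Vsub 4 g0 ^+ 2 + 2%:R * Vsub 4 g0 ^+ 3 = a ^+ 5 - b ^+ 5.
  by rewrite -[LHS]opprK -h opprB.
by rewrite -ab sab; ring.
Qed.

Lemma modular_equation : bev x5 x modular_coefs = x ^+ 5.
Proof.
have e := modular_algebra s_quintic kappa_g kappa_s.
(* Both sides of [e] are polynomials in [X = 1 + 4 x], and the term [X^5] gives [4^5 = 1024] times
   [x^5]; the whole difference is divisible by 1024, cancelled at the end. *)
have check : beqb (badd (bmul bX (bexp modular_B 2)) (bscale (-1) (bmul bk (bexp modular_A 2))))
    (bscale 1024 (badd (bexp [:: [::]; zone] 5) (bscale (-1) modular_coefs))).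
  by vm_compute.
have eqLR := beqbP x5 x check; clear check.
have EA : bev x5 x modular_A = 1 + (15%:R * (1 + 4%:R * x5) - 5%:R) * (1 + 4%:R * x) +
    (25%:R * (1 + 4%:R * x5) ^+ 2 - 25%:R * (1 + 4%:R * x5) + 5%:R) * (1 + 4%:R * x) ^+ 2.
  rewrite !bevD !bevM !bevD !bevZ !bevX !bev_bc bev_bk bev_bX.
  by rewrite (Zr_nat _ 1) (Zr_nat _ 15) (Zr_nat _ 25) ?(Zr_nat _ 5) (Zr_opp _ 25) (Zr_opp _ 5); ring.
have EB : bev x5 x modular_B = 5%:R * (1 + 4%:R * x5) + (25%:R * (1 + 4%:R * x5) ^+ 2 -
    15%:R * (1 + 4%:R * x5)) * (1 + 4%:R * x) + (1 + 4%:R * x) ^+ 2.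
  rewrite /modular_B 2!bevD bevM bevD 3!bevZ 2!bevX bev_bk bev_bX.
  by rewrite (Zr_nat _ 5) (Zr_nat _ 25) (Zr_opp _ 15); ring.
have L0 : bev x5 x (badd (bmul bX (bexp modular_B 2))
    (bscale (-1) (bmul bk (bexp modular_A 2)))) = 0.
  rewrite bevD (bevM _ _ bX) (bevX _ _ modular_B) bevZ (bevM _ _ bk) (bevX _ _ modular_A).
  by rewrite EA EB bev_bk bev_bX e ZrN1 mulN1r subrr.
have RF : bev x5 x (bscale 1024 (badd (bexp [:: [::]; zone] 5) (bscale (-1) modular_coefs))) =
    1024%:R * (x ^+ 5 - bev x5 x modular_coefs).
  rewrite bevZ bevD (bevX _ _ [:: [::]; zone]) bevZ ZrN1 mulN1r 2!bev_cons bev_nil zev_one.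
  by rewrite zev_nil mulr0 addr0 mulr1 add0r (Zr_nat _ 1024).
have e0 := etrans (esym RF) (etrans (esym eqLR) L0).
have := @natr_inj 1024 (x ^+ 5 - bev x5 x modular_coefs) 0 isT.
by rewrite mulr0 e0 => /(_ erefl)/eqP; rewrite subr_eq0 => /eqP.
Qed.

(** At [x = -1/5] the modular polynomial [x^5 - M(x)], times 3125, equals [- (1 + 5 T)^5]. Hence
    [(1 + 5 T)^5 + 3125 (x^5 - M(x))] is divisible by [1 + 5 x], and [cofactor_coefs] is the
    quotient. *)
Lemma cofactor_equation : (1 + 5%:R * x) * bev x5 x cofactor_coefs = (1 + 5%:R * x5) ^+ 5.
Proof.
have check : beqb (bmul [:: [:: 1]; [:: 5]]%BZ cofactor_coefs)
    (badd (bexp [:: [:: 1; 5]]%BZ 5)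
      (bscale 3125 (badd (bexp [:: [::]; zone] 5) (bscale (-1) modular_coefs)))).
  by vm_compute.
have eqLR := beqbP x5 x check; clear check.
have E1 : bev x5 x [:: [:: 1]; [:: 5]]%BZ = 1 + 5%:R * x.
  rewrite 2!bev_cons bev_nil 2!zev_cons zev_nil (Zr_nat _ 1) (Zr_nat _ 5); ring.
have E2 : bev x5 x [:: [:: 1; 5]]%BZ = 1 + 5%:R * x5.
  rewrite bev_cons bev_nil 2!zev_cons zev_nil (Zr_nat _ 1) (Zr_nat _ 5); ring.
have L0 : bev x5 x (bmul [:: [:: 1]; [:: 5]]%BZ cofactor_coefs) =
    (1 + 5%:R * x) * bev x5 x cofactor_coefs.
  by rewrite bevM E1.
rewrite -L0 eqLR bevD bevX E2 bevZ bevD (bevX _ _ [:: [::]; zone]) bevZ modular_equation.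
rewrite ZrN1 mulN1r 2!bev_cons bev_nil zev_one zev_nil mulr0 addr0 mulr1 add0r subrr mulr0.
by rewrite addr0.
Qed.

(** * [Phi] in terms of [sigma], and the traces of the powers of [sigma] *)

Lemma Phi_clearing (R : comUnitRingType) (P x C sigma p ph F1 F2 F5 F10 F25 F50 z : R) :
  p \is a GRing.unit -> F1 \is a GRing.unit -> F2 \is a GRing.unit ->
  F5 \is a GRing.unit -> F25 \is a GRing.unit ->
  P * (F1 * F2 ^+ 2) = z ^+ 5 * (F25 * F50 ^+ 2) ->
  x * (F1 ^+ 3 * F5) = z * (F2 * F10 ^+ 3) ->
  C * (F25 ^+ 3 * F5) = F50 * F10 ^+ 3 -> ph * F2 = F1 ^+ 2 -> p * F50 = F25 ^+ 2 ->
  sigma * p = ph -> P * C ^+ 5 = sigma ^+ 7 * x ^+ 5.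
Proof.
move=> pu u1 u2 u5 u25 Pe xe Ce pe p25 se.
have u : F1 ^+ 15 * F2 ^+ 7 * F5 ^+ 5 * F25 ^+ 15 * p ^+ 7 \is a GRing.unit.
  exact: (unitM (unitM (unitM (unitM (unitX 15 u1) (unitX 7 u2)) (unitX 5 u5))
    (unitX 15 u25)) (unitX 7 pu)).
apply: (mulIr u).
transitivity ((P * (F1 * F2 ^+ 2)) * (C * (F25 ^+ 3 * F5)) ^+ 5 * F1 ^+ 14 * F2 ^+ 5 * p ^+ 7).
  by ring.
rewrite Pe Ce.
transitivity (z ^+ 5 * F25 * F10 ^+ 15 * F1 ^+ 14 * F2 ^+ 5 * (p * F50) ^+ 7); first by ring.
rewrite p25; symmetry.
transitivity ((sigma * p * F2) ^+ 7 * (x * (F1 ^+ 3 * F5)) ^+ 5 * F25 ^+ 15); first by ring.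
by rewrite se pe xe; ring.
Qed.

Lemma Phi_s : Phi * (1 + Vsub 4 g0) ^+ 5 = sigma ^+ 7 * x ^+ 5.
Proof.
have [a [b [_ C1E]]] := level50_structure; rewrite -C1E.
have pu : Vsub 4 (Vsub 4 phi) \is a GRing.unit.
  by apply: Vsub_unit; apply: Vsub_unit; exact: phi_unit.
have u1 : f 1 \is a GRing.unit by exact: f_unit.
have u2 : f 2 \is a GRing.unit by exact: f_unit.
have u5 : f 5 \is a GRing.unit by exact: f_unit.
have u25 : f 25 \is a GRing.unit by exact: f_unit.
exact: (Phi_clearing pu u1 u2 u5 u25 PhiE xE C0E phiE phi25 sE).
Qed.

Lemma U5_natM n a : U5 (n%:R * a) = n%:R * U5 a.
Proof. by rewrite -[X in U5 (X * _)](rmorph_nat (Vsub 4)) U5_VsubM. Qed.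

Lemma U5_1 : U5 1 = 1.
Proof. by rewrite -[in LHS](Vsub1 4) U5_Vsub. Qed.

Lemma U5_lin m n (c g A B D : laurent int) :
  U5 (Vsub 4 c * A - m%:R * (Vsub 4 g * B) - n%:R * (Vsub 4 g * (Vsub 4 g * D))) =
  c * U5 A - m%:R * (g * U5 B) - n%:R * (g * (g * U5 D)).
Proof.
rewrite 2!raddfB /= (U5_natM m (Vsub 4 g * B)) (U5_natM n (Vsub 4 g * (Vsub 4 g * D))).
by rewrite (U5_VsubM c A) (U5_VsubM g B) (U5_VsubM g (Vsub 4 g * D)) (U5_VsubM g D).
Qed.

(* [d] is the root of the quintic; [U5] acts on its powers as a normalised trace. *)
Lemma U5_d_powers (a b : laurent int) : res 1 a -> res 4 b -> a * b = Vsub 4 g0 ->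
  b ^+ 5 - a ^+ 5 = - (Vsub 4 g0 + Vsub 4 g0 ^+ 2 + 2%:R * Vsub 4 g0 ^+ 3) ->
  let d := b - a in
  [/\ U5 d = 0, U5 (d ^+ 2) = - (2%:R * g0), U5 (d ^+ 3) = 0 & U5 (d ^+ 4) = 6%:R * g0 ^+ 2] /\
  [/\ U5 (d ^+ 5) = - (g0 + g0 ^+ 2 + 2%:R * g0 ^+ 3),
      U5 (d ^+ 6) = - (20%:R * g0 ^+ 3) &
      U5 (d ^+ 7) = 7%:R * g0 * (g0 + g0 ^+ 2 + 2%:R * g0 ^+ 3)].
Proof.
move=> ra rb ab h d; 
set h0 := g0 + g0 ^+ 2 + 2%:R * g0 ^+ 3.
have hV : b ^+ 5 - a ^+ 5 = Vsub 4 (- h0).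
  by rewrite h /h0; move: (g0) => c; rewrite rmorphN !rmorphD rmorphXn rmorphM rmorph_nat rmorphXn.
have ra2 : res 2 (a ^+ 2) by apply: (resM _ ra ra).
have rb2 : res 3 (b ^+ 2) by apply: (resM _ rb rb).
have ra3 : res 3 (a ^+ 3) by rewrite exprS; apply: (resM _ ra ra2).
have rb3 : res 2 (b ^+ 3) by rewrite exprS; apply: (resM _ rb rb2).
have ra4 : res 4 (a ^+ 4) by rewrite exprS; apply: (resM _ ra ra3).
have rb4 : res 1 (b ^+ 4) by rewrite exprS; apply: (resM _ rb rb3).
have d1 : U5 d = 0 by rewrite /d raddfB /= (U5_res _ ra)// (U5_res _ rb)// subr0.
have ra2b2 : U5 (a ^+ 2 + b ^+ 2) = 0.
  by rewrite raddfD /= (U5_res _ ra2)// (U5_res _ rb2)// addr0.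
have ra3b3 : U5 (b ^+ 3 - a ^+ 3) = 0.
  by rewrite raddfB /= (U5_res _ ra3)// (U5_res _ rb3)// subr0.
have ra4b4 : U5 (a ^+ 4 + b ^+ 4) = 0.
  by rewrite raddfD /= (U5_res _ ra4)// (U5_res _ rb4)// addr0.
move: g0 h0 => g h0 in ab hV *.
(* Each power is [b^n] plus or minus [a^n], which [U5] kills for [n < 5], and multiples of lower
   powers by [g = a b]. Zero coefficients only pad to the shape of [U5_lin]. *)
have d2 : U5 (d ^+ 2) = - (2%:R * g).
  have -> : d ^+ 2 = Vsub 4 1 * (a ^+ 2 + b ^+ 2) - 2%:R * (Vsub 4 g * 1) - 0%:R * (Vsub 4 g * (Vsub 4 g * 1)).
    by rewrite Vsub1 /d -ab; ring.
  by rewrite U5_lin ra2b2 U5_1; ring.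
have d3 : U5 (d ^+ 3) = 0.
  have -> : d ^+ 3 = Vsub 4 1 * (b ^+ 3 - a ^+ 3) - 3%:R * (Vsub 4 g * d) - 0%:R * (Vsub 4 g * (Vsub 4 g * 1)).
    by rewrite Vsub1 /d -ab; ring.
  by rewrite U5_lin ra3b3 d1; ring.
have d4 : U5 (d ^+ 4) = 6%:R * g ^+ 2.
  have -> : d ^+ 4 = Vsub 4 1 * (a ^+ 4 + b ^+ 4) - 4%:R * (Vsub 4 g * (d ^+ 2)) - 2%:R * (Vsub 4 g * (Vsub 4 g * 1)).
    by rewrite Vsub1 /d -ab; ring.
  by rewrite U5_lin ra4b4 d2 U5_1; ring.
(* De Moivre's quintic for [d]; it also reduces the sixth and seventh powers. *)
have d5E : d ^+ 5 = Vsub 4 (- h0) * 1 - 5%:R * (Vsub 4 g * d ^+ 3)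
    - 5%:R * (Vsub 4 g * (Vsub 4 g * d)).
  by rewrite -hV /d -ab; ring.
have d5 : U5 (d ^+ 5) = - h0 by rewrite d5E U5_lin d1 d3 U5_1; ring.
split; split => //.
- have -> : d ^+ 6 = Vsub 4 (- h0) * d - 5%:R * (Vsub 4 g * d ^+ 4)
    - 5%:R * (Vsub 4 g * (Vsub 4 g * d ^+ 2)) by rewrite exprS d5E; ring.
  by rewrite U5_lin d1 d2 d4; ring.
- have -> : d ^+ 7 = Vsub 4 (- h0) * d ^+ 2 - 5%:R * (Vsub 4 g * d ^+ 5)
    - 5%:R * (Vsub 4 g * (Vsub 4 g * d ^+ 3)).
    by rewrite [d ^+ 7](exprD d 2 5) [in LHS]d5E; ring.
  by rewrite U5_lin d2 d3 d5; ring.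
Qed.

(** Row [i] is [U5 (sigma^(7 - i))] as a polynomial in [g0]. The exponent 7 is that of [sigma] in
    [Phi], and five consecutive rows seed a recurrence of order 5. *)
Definition trace_s_coefs : seq (seq Z) :=
  ([:: [:: 1; -840; 3584; -9408; 1792]; [:: 1; -312; 1248; -1664; 0];
       [:: 1; -112; 448; -64; 0]; [:: 1; -48; 96; 0; 0]; [:: 1; -24; 0; 0; 0]])%BZ.

Lemma U5_combo (d : laurent int) (c1 c2 c3 c4 c5 c6 c7 : nat) :
  U5 (1 + c1%:R * d + c2%:R * d ^+ 2 + c3%:R * d ^+ 3 + c4%:R * d ^+ 4 + c5%:R * d ^+ 5
     + c6%:R * d ^+ 6 + c7%:R * d ^+ 7) =
  1 + c1%:R * U5 d + c2%:R * U5 (d ^+ 2) + c3%:R * U5 (d ^+ 3) + c4%:R * U5 (d ^+ 4)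
    + c5%:R * U5 (d ^+ 5) + c6%:R * U5 (d ^+ 6) + c7%:R * U5 (d ^+ 7).
Proof.
rewrite 7!raddfD /= U5_1 (U5_natM c1 d) (U5_natM c2 (d ^+ 2)) (U5_natM c3 (d ^+ 3)).
by rewrite (U5_natM c4 (d ^+ 4)) (U5_natM c5 (d ^+ 5)) (U5_natM c6 (d ^+ 6)) (U5_natM c7 (d ^+ 7)).
Qed.

Lemma zev5 (t : laurent int) (c0 c1 c2 c3 c4 : Z) :
  zev t [:: c0; c1; c2; c3; c4] = Zr _ c0 + Zr _ c1 * t + Zr _ c2 * t ^+ 2 +
    Zr _ c3 * t ^+ 3 + Zr _ c4 * t ^+ 4.
Proof. by rewrite !zev_cons zev_nil; ring. Qed.

Lemma U5_s_powers (i : nat) : (i < 5)%N ->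
  U5 (sigma ^+ (7 - i)) = zev g0 (nth [::] trace_s_coefs i).
Proof.
have [a [b [[ra rb ab sE' h] _]]] := level50_structure.
have := U5_d_powers ra rb ab h; rewrite sE'.
move: (b - a) (g0) => d g [] [d1 d2 d3 d4] [d5 d6 d7].
have C c1 c2 c3 c4 c5 c6 c7 := U5_combo d c1 c2 c3 c4 c5 c6 c7.
rewrite d1 d2 d3 d4 d5 d6 d7 in C.
case: i => [|[|[|[|[|//]]]]] _; rewrite [nth _ _ _]/= zev5 (Zr_nat _ 1).
- have -> : (1 + 2%:R * d) ^+ (7 - 0) = 1 + 14%:R * d + 84%:R * d ^+ 2 + 280%:R * d ^+ 3 +
    560%:R * d ^+ 4 + 672%:R * d ^+ 5 + 448%:R * d ^+ 6 + 128%:R * d ^+ 7 by ring.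
  by rewrite C (Zr_opp _ 840) (Zr_nat _ 3584) (Zr_opp _ 9408) (Zr_nat _ 1792); ring.
- have -> : (1 + 2%:R * d) ^+ (7 - 1) = 1 + 12%:R * d + 60%:R * d ^+ 2 + 160%:R * d ^+ 3 +
    240%:R * d ^+ 4 + 192%:R * d ^+ 5 + 64%:R * d ^+ 6 + 0%:R * d ^+ 7 by ring.
  by rewrite C (Zr_opp _ 312) (Zr_nat _ 1248) (Zr_opp _ 1664) (Zr_nat _ 0); ring.
- have -> : (1 + 2%:R * d) ^+ (7 - 2) = 1 + 10%:R * d + 40%:R * d ^+ 2 + 80%:R * d ^+ 3 +
    80%:R * d ^+ 4 + 32%:R * d ^+ 5 + 0%:R * d ^+ 6 + 0%:R * d ^+ 7 by ring.
  by rewrite C (Zr_opp _ 112) (Zr_nat _ 448) (Zr_opp _ 64) (Zr_nat _ 0); ring.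
- have -> : (1 + 2%:R * d) ^+ (7 - 3) = 1 + 8%:R * d + 24%:R * d ^+ 2 + 32%:R * d ^+ 3 +
    16%:R * d ^+ 4 + 0%:R * d ^+ 5 + 0%:R * d ^+ 6 + 0%:R * d ^+ 7 by ring.
  by rewrite C (Zr_opp _ 48) (Zr_nat _ 96) (Zr_nat _ 0); ring.
- have -> : (1 + 2%:R * d) ^+ (7 - 4) = 1 + 6%:R * d + 12%:R * d ^+ 2 + 8%:R * d ^+ 3 +
    0%:R * d ^+ 4 + 0%:R * d ^+ 5 + 0%:R * d ^+ 6 + 0%:R * d ^+ 7 by ring.
  by rewrite C (Zr_opp _ 24) (Zr_nat _ 0); ring.
Qed.

(** * Initial values *)

Definition zk : seq Z := [:: 1; 4]%BZ.

Lemma zev_zk (t : laurent int) : zev t zk = 1 + 4%:R * t.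
Proof. by rewrite 2!zev_cons zev_nil (Zr_nat _ 1) (Zr_nat _ 4); ring. Qed.

(** The numerator [(1 + 4 t)^n l(t / (1 + 4 t))], which turns polynomials in [g0] into polynomials
    in [x]. *)
Fixpoint homog (n : nat) (l : seq Z) : seq Z :=
  if l is c :: l' then zadd (zscale c (zexp zk n)) (zmul zX (homog n.-1 l')) else [::].

Lemma zev_zX (t : laurent int) : zev t zX = t.
Proof. by rewrite 2!zev_cons zev_nil (Zr_nat _ 0) (Zr_nat _ 1); ring. Qed.

Lemma zev_homog (t u : laurent int) n l : (size l <= n.+1)%N -> (1 + 4%:R * t) * u = t ->
  zev t (homog n l) = (1 + 4%:R * t) ^+ n * zev u l.
Proof.
move=> sl ut; elim: l n sl => [|c l IH] n sl; first by rewrite !zev_nil mulr0.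
rewrite [homog _ _]/= zevD zevZ zevX zevM zev_zX zev_zk zev_cons.
case: n sl => [|n] sl.
  by case: l IH sl => // _ _; rewrite [homog _ _]/= !zev_nil; ring.
rewrite IH//=; move: (zev u l) (Zr _ c) => A B.
transitivity (B * (1 + 4%:R * t) ^+ n.+1 + (1 + 4%:R * t) * u * ((1 + 4%:R * t) ^+ n * A)).
  by rewrite ut.
by rewrite exprS; ring.
Qed.

Lemma kappa_g0 : (1 + 4%:R * x) * g0 = x.
Proof.
apply: (@natr_inj 4) => //.
transitivity (1 + 4%:R * x - (1 + 4%:R * x) * (1 - 4%:R * g0)); last by rewrite x_g0; ring.
by ring.
Qed.

Definition next_row (w : seq (seq Z)) : seq Z :=
  let l := nth [::] w in
  let k3 := zexp zk 3 in let k2 := zexp zk 2 in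
  zadd (zmul k3 (l 0%N)) (zadd (zmul (zscale (-5) k3) (l 1%N))
    (zadd (zmul (zadd (zscale 15 k3) (zscale (-5) k2)) (l 2%N))
    (zadd (zmul (zadd (zscale (-25) k3) (zscale 15 k2)) (l 3%N))
      (zmul (zadd (zscale 25 k3) (zadd (zscale (-25) k2) (zscale 5 zk))) (l 4%N))))).

(* [window j] lists the numerators over [(1 + 4 x)^4] of the traces of
   [sigma^(7 - j - i)] for [i < 5]. *)
Definition window (j : nat) : seq (seq Z) :=
  iter j (fun w => rcons (behead w) (next_row w)) (map (homog 4) trace_s_coefs).

Lemma size_window j : size (window j) = 5.
Proof.
elim: j => // j IH; rewrite /window iterS -/(window j) size_rcons size_behead IH.
by [].
Qed.

(** The constant term of the quintic in [sigma] is [- (1 - 4 g)^3], so multiplying by [k^3] makes it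
    [-1]. Times [rho^5], this expresses [rho^5] by lower powers with coefficients polynomial in
    [k]. *)
Lemma scaled_quintic : let k := 1 + 4%:R * x5 in
  k ^+ 3 * sigma ^+ 5 - 5%:R * k ^+ 3 * sigma ^+ 4 + (15%:R * k ^+ 3 - 5%:R * k ^+ 2) * sigma ^+ 3
  - (25%:R * k ^+ 3 - 15%:R * k ^+ 2) * sigma ^+ 2
  + (25%:R * k ^+ 3 - 25%:R * k ^+ 2 + 5%:R * k) * sigma = 1.
Proof.
have := kappa_g; have := s_quintic => /=; move: (1 + 4%:R * x5) (Vsub 4 g0) sigma => k g t e kg.
transitivity (k ^+ 3 * ((t - 1) ^+ 5 + 20%:R * g * (t - 1) ^+ 3 + 80%:R * g ^+ 2 * (t - 1)
    + 32%:R * (g + g ^+ 2 + 2%:R * g ^+ 3))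
  + 5%:R * k ^+ 2 * (k * (1 - 4%:R * g) - 1) * t ^+ 3
  - 15%:R * k ^+ 2 * (k * (1 - 4%:R * g) - 1) * t ^+ 2
  + (25%:R * k ^+ 2 * (k * (1 - 4%:R * g) - 1) - 5%:R * k * ((k * (1 - 4%:R * g)) ^+ 2 - 1)) * t
  + (k * (1 - 4%:R * g)) ^+ 3); first by ring.
by rewrite e kg; ring.
Qed.

Definition rho : laurent int := sigma^-1.

Lemma s_rho : sigma * rho = 1. Proof. exact: divrr s_unit. Qed.

Lemma U5_lin5 (c0 c1 c2 c3 c4 A0 A1 A2 A3 A4 : laurent int) :
  c0 * U5 A0 - c1 * U5 A1 + c2 * U5 A2 - c3 * U5 A3 + c4 * U5 A4 =
  U5 (Vsub 4 c0 * A0 - Vsub 4 c1 * A1 + Vsub 4 c2 * A2 - Vsub 4 c3 * A3 + Vsub 4 c4 * A4).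
Proof.
rewrite raddfD raddfB raddfD raddfB /= (U5_VsubM c0 A0) (U5_VsubM c1 A1) (U5_VsubM c2 A2).
by rewrite (U5_VsubM c3 A3) (U5_VsubM c4 A4).
Qed.

Lemma Vsub_quintic_coefs (k : laurent int) :
  [/\ Vsub 4 (k ^+ 3) = Vsub 4 k ^+ 3, Vsub 4 (5%:R * k ^+ 3) = 5%:R * Vsub 4 k ^+ 3,
   Vsub 4 (15%:R * k ^+ 3 - 5%:R * k ^+ 2) = 15%:R * Vsub 4 k ^+ 3 - 5%:R * Vsub 4 k ^+ 2,
   Vsub 4 (25%:R * k ^+ 3 - 15%:R * k ^+ 2) = 25%:R * Vsub 4 k ^+ 3 - 15%:R * Vsub 4 k ^+ 2 &
   Vsub 4 (25%:R * k ^+ 3 - 25%:R * k ^+ 2 + 5%:R * k) =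
     25%:R * Vsub 4 k ^+ 3 - 25%:R * Vsub 4 k ^+ 2 + 5%:R * Vsub 4 k].
Proof.
have V n m : Vsub 4 (n%:R * k ^+ m) = n%:R * Vsub 4 k ^+ m.
  by rewrite rmorphM rmorph_nat rmorphXn.
have V1 n : Vsub 4 (n%:R * k) = n%:R * Vsub 4 k by rewrite rmorphM rmorph_nat.
split; [exact: rmorphXn|exact: V|by rewrite rmorphB /= !V|by rewrite rmorphB /= !V|].
by rewrite rmorphD rmorphB /= (V 25%N 3%N) (V 25%N 2%N) (V1 5%N).
Qed.

Lemma trace_recurrence j : let k := 1 + 4%:R * x in let t i := U5 (sigma ^+ 7 * rho ^+ i) in
  t (j + 5)%N = k ^+ 3 * t j - 5%:R * k ^+ 3 * t (j + 1)%N
    + (15%:R * k ^+ 3 - 5%:R * k ^+ 2) * t (j + 2)%N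
    - (25%:R * k ^+ 3 - 15%:R * k ^+ 2) * t (j + 3)%N
    + (25%:R * k ^+ 3 - 25%:R * k ^+ 2 + 5%:R * k) * t (j + 4)%N.
Proof.
have := scaled_quintic; have := s_rho; rewrite -kappa_V /=.
move: (1 + 4%:R * x) (rho) (sigma) => k r t tr eq5.
rewrite U5_lin5; congr U5.
have [-> -> -> -> ->] := Vsub_quintic_coefs k.
move: (Vsub 4 k) eq5 => {}k eq5; rewrite !exprD.
transitivity ((t ^+ 7 * (r ^+ j * r ^+ 5)) * 1); first by rewrite mulr1.
rewrite -[in LHS]eq5; move: (t ^+ 7) (r ^+ j) => A B.
transitivity (k ^+ 3 * (A * B) * (t * r) ^+ 5 - 5%:R * k ^+ 3 * (A * B * r) * (t * r) ^+ 4
  + (15%:R * k ^+ 3 - 5%:R * k ^+ 2) * (A * B * r ^+ 2) * (t * r) ^+ 3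
  - (25%:R * k ^+ 3 - 15%:R * k ^+ 2) * (A * B * r ^+ 3) * (t * r) ^+ 2
  + (25%:R * k ^+ 3 - 25%:R * k ^+ 2 + 5%:R * k) * (A * B * r ^+ 4) * (t * r)); first by ring.
by rewrite tr; ring.
Qed.

Lemma zev_next_row (t : laurent int) w : let k := 1 + 4%:R * t in
  let l i := zev t (nth [::] w i) in
  zev t (next_row w) = k ^+ 3 * l 0%N - 5%:R * k ^+ 3 * l 1%N
    + (15%:R * k ^+ 3 - 5%:R * k ^+ 2) * l 2%N - (25%:R * k ^+ 3 - 15%:R * k ^+ 2) * l 3%N
    + (25%:R * k ^+ 3 - 25%:R * k ^+ 2 + 5%:R * k) * l 4%N.
Proof.
cbv zeta; rewrite /next_row; cbv zeta.
have := zevX t zk 3; have := zevX t zk 2; have := zev_zk t.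
move: zk (zexp zk 2) (zexp zk 3) => k k2 k3 e1; rewrite e1 => e2 e3.
rewrite !(zevD, zevM, zevZ) e1 e2 e3.
rewrite (Zr_opp _ 5) (Zr_nat _ 15) (Zr_opp _ 25) (Zr_nat _ 25) (Zr_nat _ 5); ring.
Qed.

Lemma U5_window j i : (i < 5)%N ->
  (1 + 4%:R * x) ^+ 4 * U5 (sigma ^+ 7 * rho ^+ (j + i)) = zev x (nth [::] (window j) i).
Proof.
elim: j i => [|j IH] i i5.
  rewrite add0n; have -> : window 0 = map (homog 4) trace_s_coefs by [].
  have si : (size (nth [::] trace_s_coefs i) <= 5)%N by case: i i5 => [|[|[|[|[|]]]]].
  rewrite (nth_map [::]); last exact: i5.
  rewrite (zev_homog si kappa_g0).
  rewrite -U5_s_powers//; congr (_ * U5 _); have := s_rho; move: (sigma) (rho) => t r tr.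
  have -> : (7 = (7 - i) + i)%N by lia.
  by rewrite exprD addnK -mulrA -exprMn tr expr1n mulr1.
have -> : window j.+1 = rcons (behead (window j)) (next_row (window j)) by [].
rewrite nth_rcons size_behead size_window.
case: ltngtP => [i4|i4|->]; last 2 first.
- by lia.
- have -> : (j.+1 + 4 = j + 5)%N by lia.
  rewrite zev_next_row -!IH// trace_recurrence addn0; ring.
by rewrite nth_behead -IH// addSnnS.
Qed.

(** By [rho_sq], [4 (1 + 4 x5) x = rho^2 - (1 + 4 x5)]: a further factor [x] is a difference of step
    2 in the exponent of [rho]. *)
Fixpoint dtable (i o : nat) : seq Z :=
  if i is i'.+1 then zadd (dtable i' o.+2) (zscale (-1) (zmul zk (dtable i' o)))
  else nth [::] (window o) 0.

Lemma rho_sq : rho ^+ 2 = (1 + 4%:R * x5) * (1 + 4%:R * x).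
Proof.
have := kappa_s; have := s_rho; move: (1 + 4%:R * x5) (1 + 4%:R * x) (sigma) (rho) => k X t r tr e.
by rewrite -[LHS]mul1r -e -mulrA -exprMn tr expr1n mulr1.
Qed.

Lemma U5_dtable i o :
  (1 + 4%:R * x) ^+ 4 * U5 (sigma ^+ 7 * rho ^+ o * (4%:R * (1 + 4%:R * x5) * x) ^+ i) =
  zev x (dtable i o).
Proof.
elim: i o => [|i IH] o; first by rewrite expr0 mulr1 -U5_window// addn0.
rewrite [dtable _ _]/= zevD zevZ zevM -!IH zev_zk ZrN1.
have -> : sigma ^+ 7 * rho ^+ o * (4%:R * (1 + 4%:R * x5) * x) ^+ i.+1 =
    sigma ^+ 7 * rho ^+ o.+2 * (4%:R * (1 + 4%:R * x5) * x) ^+ i -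
    Vsub 4 (1 + 4%:R * x) * (sigma ^+ 7 * rho ^+ o * (4%:R * (1 + 4%:R * x5) * x) ^+ i).
  have := rho_sq; rewrite kappa_V; move: (x5) (x) (rho) (sigma) => a b r t e.
  have -> : r ^+ o.+2 = r ^+ o * r ^+ 2 by rewrite -exprD addn2.
  by rewrite e [_ ^+ i.+1]exprS; ring.
by rewrite raddfB /= U5_VsubM; ring.
Qed.

(** A cross-multiplied certificate. The factor [4^i] and [i] of the powers of [1 + 4 x] come from
    the scaling of [x] in [dtable], the other four powers from [homog 4]. *)
Lemma U5_numerator (o i : nat) (l : seq Z) (j : nat) :
  zeqb (zmul (zexp zk j) (dtable i o)) (zscale (Z.pow 4 (Z.of_nat i)) (zmul (zexp zk (i + 4)) l)) ->
  (1 + 4%:R * x) ^+ j * U5 (sigma ^+ 7 * rho ^+ o * x ^+ i) = zev x l.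
Proof.
move=> /(zeqbP x); rewrite zevZ (zevM _ (zexp zk j)) -U5_dtable (zevM _ (zexp zk (i + 4))).
rewrite 2!zevX zev_zk.
have -> : Zr (laurent int) (Z.pow 4 (Z.of_nat i)) = (4 ^ i)%:R.
  by rewrite -Zr_nat; congr Zr; lia.
have -> : sigma ^+ 7 * rho ^+ o * (4%:R * (1 + 4%:R * x5) * x) ^+ i =
    (4 ^ i)%:R * (Vsub 4 ((1 + 4%:R * x) ^+ i) * (sigma ^+ 7 * rho ^+ o * x ^+ i)).
  rewrite rmorphXn /= kappa_V natrX; move: (x5) (x) (sigma) (rho) => a b t r.
  by rewrite -mulrA exprMn exprMn; ring.
rewrite U5_natM U5_VsubM; move: (U5 _) (zev x l) => A B e.
have ku : (1 + 4%:R * x) ^+ (i + 4) \is a GRing.unit by apply: unitX; exact: kappa_unit.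
apply: (mulrI ku); apply: (@natr_inj (4 ^ i)); first by rewrite expn_gt0.
by rewrite -e exprD; ring.
Qed.

Lemma U1_initial i : (i < 5)%N -> U5 (x ^+ i) = zev x (nth [::] U1_coefs i).
Proof.
have E7 : sigma ^+ 7 * rho ^+ 7 = 1 by rewrite -exprMn s_rho expr1n.
have H j l := @U5_numerator 7 j l 0; rewrite E7 in H.
move=> i5; have := H i (nth [::] U1_coefs i); rewrite expr0 2!mul1r; apply.
by case: i i5 => [|[|[|[|[|]]]]]// _; vm_compute.
Qed.

Lemma one_5x : 1 + 5%:R * x = (1 + 4%:R * x) * (1 + g0).
Proof. by have := kappa_g0; move: (x) (g0) => a g e; rewrite mulrDr e; ring. Qed.

Lemma quotient_clearing (R : comUnitRingType) (k g P X sigma Y : R) : X \is a GRing.unit ->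
  P * (1 + g) ^+ 5 = sigma ^+ 7 * X ^+ 5 ->
  (k * (1 + g)) ^+ 5 * (P / X ^+ 5 * Y) = k ^+ 5 * (sigma ^+ 7 * 1 * Y).
Proof.
move=> xu e; apply: (mulIr (unitX 5 xu)).
transitivity (k ^+ 5 * (1 + g) ^+ 5 * (P / X ^+ 5 * X ^+ 5) * Y).
  by rewrite exprMn; move: (X ^+ 5) (_^-1) => A B; ring.
rewrite (divrK (unitX 5 xu)).
transitivity (k ^+ 5 * (P * (1 + g) ^+ 5) * Y); first by ring.
by rewrite e; ring.
Qed.

(** Inside [U5] the factor [1 + 5 x] appears at [q^5], as [(1 + 4 T) (1 + g)]; its fifth power
    cancels the denominator in [Phi / x^5 = sigma^7 / (1 + g)^5], leaving the case [o = 0], [j = 5]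
    of [U5_numerator]. *)
Lemma U0_initial i : (i < 5)%N ->
  (1 + 5%:R * x) ^+ 5 * U5 (Phi / x ^+ 5 * x ^+ i) = zev x (nth [::] U0_coefs i).
Proof.
move=> i5; rewrite -U5_VsubM rmorphXn /= one_5x VsubM.
have -> : Vsub 4 (1 + g0) = 1 + Vsub 4 g0 by rewrite rmorphD rmorph1.
rewrite (quotient_clearing _ _ x_unit Phi_s) -rmorphXn U5_VsubM.
have := @U5_numerator 0 i (nth [::] U0_coefs i) 5; rewrite expr0; apply.
by case: i i5 => [|[|[|[|[|]]]]]// _; vm_compute.
Qed.

(** * Divisibility of the coefficients *)

Definition peval (P : {poly int}) : laurent int := (map_poly intr P).[x].

(* With [(o, e, t) = (0, 0, 0)] this is the bound [pi1 i r]; with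
   [(o, e, t) = (1, 7, 5)] it is the bound [pi0 (i - 5) r]. *)
Definition good_poly (o e t i : nat) (P : {poly int}) :=
  forall r, P`_r != 0 ->
    (i <= 5 * r + o)%N /\ ((5 ^ ((5 * r + e - i) %/ 7 - t))%N%:Z %| P`_r)%Z.

Definition good o e t i (h : laurent int) :=
  exists2 P, h = peval P & good_poly o e t i P.

Lemma pevalD P Q : peval (P + Q) = peval P + peval Q.
Proof. by rewrite /peval rmorphD hornerD. Qed.

Lemma peval_mono c l P : peval (c%:P * 'X^l * P) = c%:~R * x ^+ l * peval P.
Proof. by rewrite /peval !rmorphM /= map_polyC map_polyXn !hornerE. Qed.

Lemma good0 o e t i : good o e t i 0.
Proof.
exists 0; first by rewrite /peval rmorph0 horner0.
by move=> r; rewrite coef0 eqxx.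
Qed.

Lemma goodD o e t i h h' : good o e t i h -> good o e t i h' -> good o e t i (h + h').
Proof.
move=> [P -> hP] [Q -> hQ]; exists (P + Q); first by rewrite pevalD.
move=> r; rewrite coefD => nz.
have dvd R : good_poly o e t i R -> ((5 ^ ((5 * r + e - i) %/ 7 - t))%N%:Z %| R`_r)%Z.
  by move=> hR; have [->|/hR[]//] := eqVneq R`_r 0; rewrite dvdz0.
split; last by rewrite rpredD//; apply: dvd.
have [P0|/hP[]//] := eqVneq P`_r 0.
have [Q0|/hQ[]//] := eqVneq Q`_r 0.
by move: nz; rewrite P0 Q0 addr0 eqxx.
Qed.

(** The exponent of 5 required at [r] exceeds the one known at [r - l] by at most [v], since
    [5 l + i' - i <= 7 v] and multiples of 7 pass through the floor. On the support, [o <= e] keeps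
    the subtraction inside the quotient from truncating. *)
Lemma good_mono o e t i i' v l (c : int) h : (o <= e)%N ->
  (i <= i' + 5 * l)%N -> (5 * l + i' <= 7 * v + i)%N -> ((5 ^ v)%N%:Z %| c)%Z ->
  good o e t i' h -> good o e t i (c%:~R * x ^+ l * h).
Proof.
move=> oe il lv vc [P -> hP]; exists (c%:P * 'X^l * P); first by rewrite peval_mono.
move=> r; rewrite -mulrA coefCM coefXnM; case: ltnP => [rl|lr]; first by rewrite mulr0 eqxx.
rewrite mulf_eq0 negb_or => /andP[c0 /hP[hr hd]]; split; first by lia.
apply: dvdz_trans (dvdz_mul vc hd); rewrite -PoszM -expnD; apply: dvdn_exp2l.
by lia.
Qed.

Definition zdiv5 (v : nat) (c : Z) := Z.eqb (Z.modulo c (Z.pow 5 (Z.of_nat v))) 0.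

Lemma zdiv5P v c : zdiv5 v c -> ((5 ^ v)%N%:Z %| int_of_Z c)%Z.
Proof.
move=> /Z.eqb_eq h; have p5 : Z.pow 5 (Z.of_nat v) <> 0%BZ by lia.
have := Z.div_mod c _ p5; rewrite h Z.add_0_r => ->.
rewrite rmorphM /=; apply: dvdz_mulr.
have -> : int_of_Z (Z.pow 5 (Z.of_nat v)) = (5 ^ v)%N%:Z by lia.
exact: dvdzz.
Qed.

Lemma Zr0 (R : pzRingType) : Zr R 0%BZ = 0. Proof. by []. Qed.

Fixpoint good_coefs (o e t i r : nat) (l : seq Z) : bool :=
  if l is c :: l' then
    (Z.eqb c 0 || ((i <= 5 * r + o)%N && zdiv5 ((5 * r + e - i) %/ 7 - t) c)) &&
    good_coefs o e t i r.+1 l'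
  else true.

Lemma good_coefsP o e t i r l :
  good_coefs o e t i r l -> good o e t i (x ^+ r * zev x l).
Proof.
elim: l r => [|c l IH] r; first by move=> _; rewrite zev_nil mulr0; exact: good0.
rewrite [good_coefs _ _ _ _ _ _]/= => /andP[hc /IH hl].
rewrite zev_cons mulrDr mulrA -exprSr; apply: goodD => //.
move: hc => /orP[/Z.eqb_eq c0|/andP[hi hd]].
  by rewrite c0 Zr0 mulr0; exact: good0.
exists ((int_of_Z c)%:P * 'X^r).
  have := peval_mono (int_of_Z c) r 1; rewrite mulr1 => ->.
  by rewrite /peval rmorph1 hornerC mulr1 mulrC.
move=> r'; rewrite coefCM coefXn; case: (r' =P r) => [->|_]; last by rewrite mulr0 eqxx.
by rewrite mulr1 => _; split => //; apply: zdiv5P.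
Qed.

(* [row_weight d j l cs] says that each coefficient [c] of [cs], taken as that of
   [x5^l x^j], has 5-adic valuation at least [(5 l + j - d) / 7] and that
   [d <= j + 5 l]: multiplying by [c x5^l x^j] then turns the bounds at index
   [m + d] into those at index [m + j]. *)
Fixpoint row_weight (d j l : nat) (cs : seq Z) : bool :=
  if cs is c :: cs' then
    (Z.eqb c 0 || ((d <= j + 5 * l)%N && zdiv5 ((5 * l + j - d + 6) %/ 7) c)) &&
    row_weight d j l.+1 cs'
  else true.

Fixpoint weight (d j : nat) (B : seq (seq Z)) : bool :=
  if B is cs :: B' then row_weight d j 0 cs && weight d j.+1 B' else true.

Lemma good_row o e t d j l cs m h : (o <= e)%N -> row_weight d j l cs ->
  good o e t (m + j) h -> good o e t (m + d) (x ^+ l * zev x cs * h).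
Proof.
move=> oe; elim: cs l => [|c cs IH] l.
  by move=> _ _; rewrite zev_nil mulr0 mul0r; exact: good0.
rewrite [row_weight _ _ _ _]/= => /andP[hc /IH hcs] gh.
have -> : x ^+ l * zev x (c :: cs) * h = Zr _ c * x ^+ l * h + x ^+ l.+1 * zev x cs * h.
  by rewrite zev_cons; move: (x) (zev x cs) (Zr _ c) => y A C; rewrite exprSr; ring.
apply: goodD; last exact: hcs.
move: hc => /orP[/Z.eqb_eq c0|/andP[hd hv]].
  by rewrite c0 Zr0 !mul0r; exact: good0.
by apply: (good_mono oe _ _ (zdiv5P hv) gh); lia.
Qed.

(** A term [c x5^l x^j] of [B] leaves [U5] as [c x^l] times the value at index [m + j], so the
    weights of the terms decide everything. *)
Lemma good_bev o e t d j m B c w : (o <= e)%N -> weight d j B ->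
  (forall k, (k < size B)%N -> good o e t (m + (j + k)) (c * U5 (w * x ^+ k))) ->
  good o e t (m + d) (c * U5 (w * bev x5 x B)).
Proof.
move=> oe; elim: B j w => [|cs B IH] j w.
  by move=> _ _; rewrite bev_nil mulr0 raddf0 mulr0; exact: good0.
rewrite [weight _ _ _]/= => /andP[hcs hB] gk.
have -> : c * U5 (w * bev x5 x (cs :: B)) =
    x ^+ 0 * zev x cs * (c * U5 (w * x ^+ 0)) + c * U5 (w * x * bev x5 x B).
  rewrite bev_cons -(zev_rmorph (Vsub 4) x) !expr0 mulr1 mul1r mulrDr raddfD /=.
  by rewrite [w * Vsub 4 _]mulrC U5_VsubM [w * (x * _)]mulrA; ring.
apply: goodD; first by apply: good_row oe hcs _; rewrite -[j]addn0; apply: gk.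
apply: IH hB _ => k kB; rewrite -mulrA -exprS addSnnS; exact: gk.
Qed.

Lemma good_all_m o e t c w : (o <= e)%N ->
  (forall i, (i < 5)%N -> good o e t i (c * U5 (w * x ^+ i))) ->
  forall i, good o e t i (c * U5 (w * x ^+ i)).
Proof.
move=> oe h0; elim/ltn_ind => i IH; have [/h0//|i5] := ltnP i 5.
have -> : i = ((i - 5) + 5)%N by lia.
(* Here [d = 5]: index [i] is reached from the five indices [i - 5] to [i - 1]. *)
rewrite exprD mulrA -modular_equation; apply: (@good_bev _ _ _ _ 0) => // k k5.
by rewrite add0n -mulrA -exprD; apply: IH; move: k5; rewrite /=; lia.
Qed.

Lemma y_unit : 1 + 5%:R * x \is a GRing.unit.
Proof. exact: denominator_unit. Qed.

Lemma shift_denominator (R : comUnitRingType) (y A B : R) n : y \is a GRing.unit ->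
  y * B * (A / y ^+ n.+1) = A / y ^+ n * B.
Proof.
move=> yu; apply: (mulIr (unitX n.+1 yu)).
transitivity (y * B * (A / y ^+ n.+1 * y ^+ n.+1)); first by rewrite !mulrA.
rewrite (divrK (unitX n.+1 yu)) exprS.
transitivity (A / y ^+ n * y ^+ n * B * y); last by move: (y ^+ n) (A / _) => ? ?; ring.
by rewrite (divrK (unitX n yu)); ring.
Qed.

(** Replacing [1 / (1 + 5 x)] by the cofactor over [(1 + 5 T)^5] sends a factor [(1 + 5 x)^5] out of
    [U5], whence [5 * n]. The cofactor has nonnegative weight ([d = 0]), so the bound keeps its
    form. *)
Lemma good_all_n o e t c w : (o <= e)%N ->
  (forall i, good o e t i (c * U5 (w * x ^+ i))) ->
  forall n i, good o e t i (c * (1 + 5%:R * x) ^+ (5 * n) *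
                            U5 (w * x ^+ i / (1 + 5%:R * x) ^+ n)).
Proof.
move=> oe h0; elim=> [|n IH] i; first by rewrite muln0 !expr0 divr1 mulr1.
have -> : c * (1 + 5%:R * x) ^+ (5 * n.+1) * U5 (w * x ^+ i / (1 + 5%:R * x) ^+ n.+1) =
    c * (1 + 5%:R * x) ^+ (5 * n) *
    U5 (w * x ^+ i / (1 + 5%:R * x) ^+ n * bev x5 x cofactor_coefs).
  rewrite mulnS exprD -[RHS]mulrA -2!mulrA; congr (_ * _).
  rewrite mulrCA; congr (_ * _); rewrite -U5_VsubM; congr U5.
  rewrite rmorphXn /= Vsub_1D -cofactor_equation.
  have yu := y_unit; move: (1 + 5%:R * x) yu (bev _ _ _) (w * x ^+ i) => y yu B A.
  exact: shift_denominator.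
rewrite -[X in good _ _ _ X]addn0; apply: (@good_bev _ _ _ 0 0) => // k k5.
have -> : w * x ^+ i / (1 + 5%:R * x) ^+ n * x ^+ k = w * x ^+ (i + k) / (1 + 5%:R * x) ^+ n.
  by rewrite exprD; move: (x ^+ i) (x ^+ k) (_^-1) => A B C; ring.
by rewrite add0n; exact: IH.
Qed.

Lemma good_U1 m n : good 0 0 0 m ((1 + 5%:R * x) ^+ (5 * n) *
  U5 (x ^+ m / (1 + 5%:R * x) ^+ n)).
Proof.
have H := @good_all_n 0 0 0 1 1 isT _ n m.
rewrite !mul1r in H; apply: H.
apply: good_all_m => // i i5; rewrite !mul1r U1_initial//.
rewrite -[zev _ _]mul1r -[X in X * _](expr0 x); apply: good_coefsP.
by case: i i5 => [|[|[|[|[|]]]]]// _; vm_compute.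
Qed.

(** The weight function is [Phi / x^5], so the index is [m + 5]. Then [o = 1] encodes
    [m + 4 <= 5 r], [e = 7] gives [(5 r - m + 2) / 7], and truncated subtraction of [t = 5] is the
    maximum with 0 in [pi0]. *)
Lemma good_U0 m n : good 1 7 5 (m + 5) ((1 + 5%:R * x) ^+ (5 * n + 5) *
  U5 (Phi * (x ^+ m / (1 + 5%:R * x) ^+ n))).
Proof.
have H := @good_all_n 1 7 5 ((1 + 5%:R * x) ^+ 5) (Phi / x ^+ 5) isT _ n (m + 5).
have xu : x ^+ 5 \is a GRing.unit by apply: unitX; exact: x_unit.
have E : Phi / x ^+ 5 * x ^+ (m + 5) = Phi * x ^+ m.
  rewrite addnC exprD; move: (x ^+ m) (x ^+ 5) xu Phi => A B Bu P.
  transitivity (P / B * B * A); [exact: mulrA|by rewrite (divrK Bu)].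
rewrite E in H; rewrite [(5 * n + 5)%N]addnC exprD [Phi * _]mulrA; apply: H => i.
apply: good_all_m => // {}i i5; rewrite U0_initial//.
rewrite -[zev _ _]mul1r -[X in X * _](expr0 x); apply: good_coefsP.
by case: i i5 => [|[|[|[|[|]]]]]// _; vm_compute.
Qed.

(** * From polynomials in [x] to the coefficient functions *)

Lemma pevalE P : peval P = \sum_(k < size P) (P`_k)%:~R * x ^+ k.
Proof.
have sP : (size (map_poly intr P : {poly laurent int}) <= size P)%N by apply: size_poly.
rewrite /peval (horner_coef_wide _ sP); apply: eq_bigr => k _.
by rewrite coef_map_id0.
Qed.

Lemma fsum_peval (A : set int) (c : int -> int) (P : {poly int}) :
  (forall r, A r -> 0 <= r) -> (forall k : nat, A k -> c k = P`_k) ->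
  (forall k : nat, P`_k != 0 -> A k) ->
  \sum_(r \in A) (c r)%:~R * x ^ r = peval P.
Proof.
move=> A0 Ac PA; rewrite pevalE.
pose l := [seq Posz k | k <- iota 0 (size P)].
have ul : uniq l by rewrite map_inj_uniq ?iota_uniq// => ? ? [].
rewrite (fsbigE [seq r <- l | `[< A r >]]) ?filter_uniq//; last 2 first.
- by move=> r /=; rewrite mem_filter => /andP[/asboolP].
- move=> r Ar; rewrite mem_filter; case: r Ar => [k|k] Ar; last by have := A0 _ Ar.
  have posz_inj : injective Posz by move=> ? ? [].
  rewrite asboolT// /l (mem_map posz_inj) mem_iota /= add0n -leqNgt => kP.
  by rewrite Ac// nth_default// mul0r.
have iE : iota 0 (size P) = index_iota 0 (size P) by rewrite /index_iota subn0.
rewrite big_filter_cond big_mkcond big_map iE big_mkord.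
apply: eq_bigr => k _; case: ifP => [/andP[/asboolP Ak _]|/negP nA]; first by rewrite Ac.
have [->|/PA Ak] := eqVneq P`_k 0; first by rewrite mul0r.
by exfalso; apply: nA; rewrite asboolT//= inE.
Qed.

Lemma floor_div7 (a : int) : Num.floor (a%:~R / 7 : rat) = (a %/ 7)%Z.
Proof.
apply: floor_def; rewrite ler_pdivlMr// ltr_pdivrMr//.
have e7 : 7 = 7%Z%:~R :> rat by [].
by rewrite e7 -!intrM ler_int ltr_int; lia.
Qed.

Lemma ceil_div5 (a r : int) : (Num.ceil (a%:~R / 5 : rat) <= r) = (a <= 5 * r).
Proof.
have e5 : 5 = 5%Z%:~R :> rat by [].
by rewrite ceil_le_int ler_pdivrMr// e5 -intrM ler_int mulrC.
Qed.

Lemma pi0E (m k : nat) : (m + 4 <= 5 * k)%N ->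
  pi0 m k = ((5 * k + 7 - (m + 5)) %/ 7 - 5)%N%:Z.
Proof. by move=> mk; rewrite /pi0 floor_div7 /Num.max; case: ltP; lia. Qed.

Lemma pi1E (m k : nat) : (m <= 5 * k)%N -> pi1 m k = ((5 * k + 0 - m) %/ 7 - 0)%N%:Z.
Proof. by move=> mk; rewrite /pi1 floor_div7; lia. Qed.

(** Each [G m n] is a polynomial in [x]; one is chosen for every pair and its coefficients are
    divided exactly by the powers of 5. Its size bounds the support of [h]. *)
Lemma coefficient_function (o e t d : nat) (G : nat -> nat -> laurent int)
    (pi : int -> int -> int) (A : nat -> set int) :
  (forall m n, good o e t (m + d) (G m n)) ->
  (forall m r, A m r -> 0 <= r) ->
  (forall m k : nat, A m k <-> (m + d <= 5 * k + o)%N) ->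
  (forall m k : nat, A m k -> pi m k = ((5 * k + e - (m + d)) %/ 7 - t)%N) ->
  exists h : int -> int -> int -> int,
    (forall m n : int, finite_set [set r : int | h m n r != 0]) /\
    (forall m n : nat, G m n = \sum_(r \in A m) (h m n r * 5 ^ pi m r)%:~R * x ^ r).
Proof.
move=> hG A0 AE piE.
have /choice[P hP] : forall mn : nat * nat, exists P,
    G mn.1 mn.2 = peval P /\ good_poly o e t (mn.1 + d) P.
  by move=> mn; have [P] := hG mn.1 mn.2; exists P.
(* To be total, [h] reads [m] and [n] through absolute values and is 0 at negative [r]. *)
pose h (m n r : int) : int :=
  if r is Posz k then
    (((P (`|m|, `|n|)%N)`_k) %/ (5 ^ ((5 * k + e - (`|m| + d)) %/ 7 - t))%N%:Z)%Z
  else 0.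
exists h; split=> [m n|m n].
  apply: (@sub_finite_set _ _ [set` [seq Posz k | k <- iota 0 (size (P (`|m|, `|n|)%N))]]).
    move=> [k|//] /= nz; apply: map_f; rewrite mem_iota /= add0n ltnNge.
    by apply: contra nz => sk; rewrite nth_default// div0z.
  exact: finite_seq.
have [-> gP] := hP (m, n).
rewrite (@fsum_peval _ (fun r => h m n r * 5 ^ pi m r) (P (m, n)))//.
- exact: A0.
- move=> k Ak; rewrite (piE _ _ Ak) /h /= -exprnP.
  have -> : (5 : int) ^+ ((5 * k + e - (m + d)) %/ 7 - t) =
      (5 ^ ((5 * k + e - (m + d)) %/ 7 - t))%N%:Z by rewrite -!natz natrX.
  rewrite divzK//; have [->|/gP[]//] := eqVneq (P (m, n))`_k 0.
  by rewrite dvdz0.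
- by move=> k /gP[hk _]; apply/AE.
Qed.

Theorem theorem5p5 :
  exists h0 h1 : int -> int -> int -> int,
    (forall m n : int, finite_set [set r : int | h0 m n r != 0]) /\
    (forall m n : int, finite_set [set r : int | h1 m n r != 0]) /\
    (forall m n : nat,
      U0 (x ^+ m / (1 + 5 * x) ^+ n) =
        1 / (1 + 5 * x) ^+ (5 * n + 5) *
        \sum_(r \in [set r : int | Num.ceil ((m%:R + 4) / 5 : rat) <= r])
          (h0 m n r * 5 ^ pi0 m r)%:~R * x ^ r) /\
    (forall m n : nat,
      U1 (x ^+ m / (1 + 5 * x) ^+ n) =
        1 / (1 + 5 * x) ^+ (5 * n) *
        \sum_(r \in [set r : int | Num.ceil (m%:R / 5 : rat) <= r])
          (h1 m n r * 5 ^ pi1 m r)%:~R * x ^ r).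
Proof.
have c0 (m : nat) (r : int) : (Num.ceil ((m%:R + 4) / 5 : rat) <= r) = (m%:Z + 4 <= 5 * r).
  by rewrite -ceil_div5 intrD -pmulrn.
have c1 (m : nat) (r : int) : (Num.ceil (m%:R / 5 : rat) <= r) = (m%:Z <= 5 * r).
  by rewrite -ceil_div5 -pmulrn.
have [|||h0 [f0 e0]] := coefficient_function (pi := pi0)
    (A := fun m => [set r : int | Num.ceil ((m%:R + 4) / 5 : rat) <= r]) good_U0.
- by move=> m r /=; rewrite c0; lia.
- by move=> m k /=; rewrite c0; split; lia.
- by move=> m k /=; rewrite c0 => mk; apply: pi0E; lia.
have good1 m n : good 0 0 0 (m + 0) ((1 + 5%:R * x) ^+ (5 * n) *
    U5 (x ^+ m / (1 + 5%:R * x) ^+ n)) by rewrite addn0; exact: good_U1.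
have [|||h1 [f1 e1]] := coefficient_function (pi := pi1)
    (A := fun m => [set r : int | Num.ceil (m%:R / 5 : rat) <= r]) good1.
- by move=> m r /=; rewrite c1; lia.
- by move=> m k /=; rewrite c1; split; lia.
- by move=> m k /=; rewrite c1 [(m + 0)%N]addn0 => mk; apply: pi1E; lia.
exists h0, h1; split; first exact: f0.
split; first exact: f1.
split=> m n.
- rewrite /U0 -(e0 m n) mul1r.
  symmetry; exact: (mulKr (unitX (5 * n + 5) y_unit)).
- rewrite /U1 -(e1 m n) mul1r.
  symmetry; exact: (mulKr (unitX (5 * n) y_unit)).
Qed.
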